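(* Let $n,D\ge 1$ be integers and let $U=(u_{tk})$ be a complex random $n\times D$ matrix whose rows $u_{1\cdot},\ldots,u_{n\cdot}$ are independent and identically distributed random (row) vectors in $\mathbb{C}^D$ with $\mathbb{E}|u_{1k}|^2<\infty$ for all $k$. Let $Q:=\mathbb{E}(u_{1\cdot}^{*}u_{1\cdot})\in\mathbb{C}^{D\times D}$, with entries $q_{kj}=\mathbb{E}(\overline{u_{1k}}u_{1j})$. Assume there are finite constants $M\ge 0$ and $v_{kj}\ge 0$ ($1\le k,j\le D$) such that for all integers $\ell\ge 2$ and all $1\le k,j\le D$ $$\mathbb{E}\left[|\operatorname{Re}(\overline{u_{1k}}u_{1j}-q_{kj})|^{\ell}\right]\le 2^{-1}\ell!\,M^{\ell-2}v_{kj},\qquad \mathbb{E}\left[|\operatorname{Im}(\overline{u_{1k}}u_{1j}-q_{kj})|^{\ell}\right]\le 2^{-1}\ell!\,M^{\ell-2}v_{kj}.$$ Set $v:=\max_{1\le k,j\le D}v_{kj}$. Then for every $\varepsilon>0$, the inequality $$\left\Vert n^{-1}U^{*}U-Q\right\Vert<\varepsilon$$ holds with probability at least $$p:=1-4D^{2}\exp\left(-\frac{n\varepsilon^{2}}{D^{2}\left(4v+2\sqrt{2}\,D^{-1}M\varepsilon\right)}\right).$$ In particular, with probability not less than $p$, $$\lambda_{\min}(Q)-\varepsilon<\lambda_{\min}(n^{-1}U^{*}U)\le\lambda_{\max}(n^{-1}U^{*}U)<\lambda_{\max}(Q)+\varepsilon.$$ Consequently, if $Q$ is non-singular and $\varepsilon\in(0,\lambda_{\min}(Q))$,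 then the condition number of $U^{*}U$ is bounded by $\frac{\lambda_{\max}(Q)+\varepsilon}{\lambda_{\min}(Q)-\varepsilon}$ with probability not less than $p$.
   Context: For a matrix $A$, $A^{*}$ is its conjugate transpose, $\Vert A\Vert=\lambda_{\max}(A^{*}A)^{1/2}$ is the operator norm, and for hermitian $A$, $\lambda_{\max}(A)$, $\lambda_{\min}(A)$ are the largest and smallest eigenvalues; the condition number of $A$ is $\lambda_{\max}(A)/\lambda_{\min}(A)$. Conventions: $M^{0}=1$ also when $M=0$; if $v=M=0$, the exponential term in $p$ is interpreted as $0$. *)

(* Defs.v *)
From HB Require Import structures.
From mathcomp Require Import all_boot all_order all_algebra.
From mathcomp Require Import complex.
From mathcomp Require Import all_classical all_reals all_analysis.

Set Implicit Arguments.
Unset Strict Implicit.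
Unset Printing Implicit Defensive.

Import Order.TTheory GRing.Theory Num.Theory.
Import numFieldNormedType.Exports.

Local Open Scope classical_set_scope.
Local Open Scope complex_scope.
Local Open Scope sesquilinear_scope.
Local Open Scope ring_scope.

Section hermitian_spectrum.
Context {R : realType}.

(* Intended for hermitian A of positive size: all eigenvalues are then real,
   and the set below is finite and nonempty, so that sup is a maximum and inf
   a minimum. *)
Definition real_eigenvalues (D : nat) (A : 'M[R[i]]_D) : set R :=
  [set x : R | eigenvalue A x%:C].

Definition lambda_max (D : nat) (A : 'M[R[i]]_D) : R := sup (real_eigenvalues A).

Definition lambda_min (D : nat) (A : 'M[R[i]]_D) : R := inf (real_eigenvalues A).

Definition opnorm (m D : nat) (A : 'M[R[i]]_(m, D)) : R :=
  Num.sqrt (lambda_max (A ^t* *m A)).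

(* Meaningful for nonsingular A only, because of the convention x / 0 = 0. *)
Definition condition_number (D : nat) (A : 'M[R[i]]_D) : R :=
  lambda_max A / lambda_min A.

End hermitian_spectrum.

Section random_rows.
Context {d : measure_display} {T : measurableType d} {R : realType}.

Definition complex_random_variable (X : T -> R[i]) : Prop :=
  measurable_fun setT (fun w => complex.Re (X w)) /\
  measurable_fun setT (fun w => complex.Im (X w)).

(* The value is the expectation only when the real and imaginary parts of X
   are integrable. *)
Definition complex_expectation (P : probability T R) (X : T -> R[i]) : R[i] :=
  fine 'E_P[fun w => complex.Re (X w)] +i*
  fine 'E_P[fun w => complex.Im (X w)].

(* The Borel sigma-algebra of C^D = R^(2 D), generated by the real and
   imaginary parts of the coordinates. *)
Definition borel_row (D : nat) : set (set 'rV[R[i]]_D) :=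
  <<s [set B : set 'rV[R[i]]_D | exists (k : 'I_D) (A : set R),
         measurable A /\
         (B = [set x : 'rV[R[i]]_D | A (complex.Re (x 0 k))] \/
          B = [set x : 'rV[R[i]]_D | A (complex.Im (x 0 k))])] >>.

Definition independent_rows (P : probability T R) (n D : nat)
    (U : T -> 'M[R[i]]_(n, D)) : Prop :=
  forall (J : {set 'I_n}) (B : 'I_n -> set 'rV[R[i]]_D),
    (forall t, t \in J -> borel_row (B t)) ->
    P [set w | forall t, t \in J -> B t (row t (U w))] =
    (\prod_(t in J) P [set w | B t (row t (U w))])%E.

Definition identically_distributed_rows (P : probability T R) (n D : nat)
    (U : T -> 'M[R[i]]_(n, D)) : Prop :=
  forall (s t : 'I_n) (B : set 'rV[R[i]]_D), borel_row B ->
    P [set w | B (row s (U w))] = P [set w | B (row t (U w))].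

(* E (u^* u) for the row u = u_t of U. *)
Definition second_moment_mx (P : probability T R) (n D : nat)
    (U : T -> 'M[R[i]]_(n, D)) (t : 'I_n) : 'M[R[i]]_D :=
  \matrix_(k < D, j < D)
    complex_expectation P (fun w => (U w t k)^*%R * U w t j).

End random_rows.

Section probability_bound.
Context {R : realType}.

(* The seed 0 is harmless for nonnegative entries. *)
Definition max_entry (D : nat) (v : 'M[R]_D) : R :=
  \big[Num.max/0]_(kj : 'I_D * 'I_D) v kj.1 kj.2.

Definition exp_term (n D : nat) (M v eps : R) : R :=
  if (v == 0) && (M == 0) then 0
  else expR (- ((n%:R * eps ^+ 2) /
                (D%:R ^+ 2 *
                 (4 * v + 2 * Num.sqrt 2 * D%:R^-1 * M * eps)))).

Definition prob_bound (n D : nat) (M v eps : R) : R :=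
  1 - 4 * D%:R ^+ 2 * exp_term n D M v eps.

End probability_bound.

(* Main.v *)
Require Import Defs.
From HB Require Import structures.
From mathcomp Require Import all_boot all_order all_algebra.
From mathcomp Require Import complex.
From mathcomp Require Import all_classical all_reals all_analysis.
From mathcomp Require Import measurable_realfun.
From mathcomp Require Import ring lra.

Set Implicit Arguments.
Unset Strict Implicit.
Unset Printing Implicit Defensive.

Import Order.TTheory GRing.Theory Num.Theory.
Import numFieldNormedType.Exports.
Local Open Scope classical_set_scope.
Local Open Scope complex_scope.
Local Open Scope sesquilinear_scope.
Local Open Scope ring_scope.

(* Each entry of n^-1 U^* U - Q is an average of n independent centered copies
   of a variable whose real and imaginary parts satisfy Bernstein's moment
   condition.  Bernstein's inequality and a union bound over the 2 D^2 real
   and imaginary parts and the two signs show that, with probability at least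
   p, all these parts are smaller than eps / (sqrt 2 D); then the Frobenius
   norm, hence the operator norm, is smaller than eps, and the eigenvalue
   bounds follow by Weyl's inequality.  The events in the statement also have
   to be measurable: for hermitian A, lambda_max A <= c holds if and only if
   all coefficients of the characteristic polynomial of A - c are nonnegative,
   and these coefficients are polynomials in the entries of A. *)

(** * Hermitian matrices *)

(** Independence is given only as a product rule for events, so the factorisation of the exponential
    moment of a sum has to be derived: superlevel sets are replaced by nonnegative functions through
    the layer-cake formula, one factor at a time. Exponential moments are not assumed finite either;
    the moment condition bounds the series of exp y - 1 - y by a geometric one of ratio lam M,
    whence the restriction lam M < 1. For v = 0 the usual parameter lam reaches the excluded value 1
    / M, or infinity if M = 0 too, so these cases get parameters of their own. In the claim on the
    condition number, the quotient is replaced by the inequality lambda_max <= C lambda_min on the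
    event lambda_min > 0, which for a Gram matrix is non-singularity. *)

Section hermitian_matrices.
Context {R : realType}.
Local Notation C := R[i].

(** Real-valued, unlike the norm of [R[i]], so that the estimates take place in the ordered field
    [R]. *)
Definition sqmod (z : C) : R := complex.Re z ^+ 2 + complex.Im z ^+ 2.

Lemma sqmod_ge0 z : 0 <= sqmod z.
Proof. by rewrite addr_ge0 ?sqr_ge0. Qed.

Lemma sqmodE (z : C) : z * z^* = (sqmod z)%:C.
Proof. by rewrite -normCK /sqmod add_Re2_Im2. Qed.

Lemma sqmod_eq0 z : (sqmod z == 0) = (z == 0).
Proof.
by rewrite /sqmod paddr_eq0 ?sqr_ge0// !sqrf_eq0 eq_complex.
Qed.

Lemma Re_sum (I : Type) (s : seq I) (Q : pred I) (F : I -> C) :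
  complex.Re (\sum_(i <- s | Q i) F i) = \sum_(i <- s | Q i) complex.Re (F i).
Proof.
by elim/big_rec2: _ => //= i y z _ <-; case: (F i) z => [? ?] [? ?].
Qed.

Lemma Im_sum (I : Type) (s : seq I) (Q : pred I) (F : I -> C) :
  complex.Im (\sum_(i <- s | Q i) F i) = \sum_(i <- s | Q i) complex.Im (F i).
Proof.
by elim/big_rec2: _ => //= i y z _ <-; case: (F i) z => [? ?] [? ?].
Qed.

Lemma Re_scale (a : R) (z : C) : complex.Re (a%:C * z) = a * complex.Re z.
Proof. by case: z => x y /=; rewrite mul0r subr0. Qed.

Lemma Im_scale (a : R) (z : C) : complex.Im (a%:C * z) = a * complex.Im z.
Proof. by case: z => x y /=; rewrite mul0r addr0. Qed.

Lemma ReB (x y : C) : complex.Re (x - y) = complex.Re x - complex.Re y.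
Proof. by case: x y => [? ?] [? ?]. Qed.

Lemma ImB (x y : C) : complex.Im (x - y) = complex.Im x - complex.Im y.
Proof. by case: x y => [? ?] [? ?]. Qed.

(** Vectors are rows because [eigenvalue] refers to row eigenvectors. The number is real for
    hermitian A; taking the real part puts it in [R]. *)
Definition quad (D : nat) (A : 'M[C]_D) (u : 'rV[C]_D) : R :=
  complex.Re ((u *m A *m u^t*) 0 0).

Definition sqnorm (D : nat) (u : 'rV[C]_D) : R := \sum_i sqmod (u 0 i).

Lemma sqnorm_ge0 (D : nat) (u : 'rV[C]_D) : 0 <= sqnorm u.
Proof. by apply: sumr_ge0 => i _; exact: sqmod_ge0. Qed.

Lemma sqnorm_gt0 (D : nat) (u : 'rV[C]_D) : u != 0 -> 0 < sqnorm u.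
Proof.
move=> u0; rewrite lt_neqAle sqnorm_ge0 andbT eq_sym.
apply: contra u0 => /eqP u0; apply/eqP/rowP => i; rewrite mxE.
apply/eqP; rewrite -sqmod_eq0.
by apply/eqP/(psumr_eq0P _ u0) => // j _; exact: sqmod_ge0.
Qed.

Lemma row_mul_adj (D : nat) (u : 'rV[C]_D) : (u *m u^t*) 0 0 = (sqnorm u)%:C.
Proof.
by rewrite mxE rmorph_sum/=; apply: eq_bigr => i _; rewrite !mxE sqmodE.
Qed.

Lemma quadD (D : nat) (A B : 'M[C]_D) u : quad (A + B) u = quad A u + quad B u.
Proof.
rewrite /quad mulmxDr mulmxDl mxE.
by case: ((u *m A *m _) 0 0) ((u *m B *m _) 0 0) => [? ?] [? ?].
Qed.

Lemma quad_eigen (D : nat) (A : 'M[C]_D) u (x : R) :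
  u *m A = x%:C *: u -> quad A u = x * sqnorm u.
Proof. by move=> ux; rewrite /quad ux -scalemxAl mxE row_mul_adj// Re_scale. Qed.

Lemma adjmx_mul (m n p : nat) (A : 'M[C]_(m, n)) (B : 'M[C]_(n, p)) :
  (A *m B)^t* = B^t* *m A^t*.
Proof. by rewrite trmx_mul map_mxM. Qed.

Lemma adjmxB (m n : nat) (A B : 'M[C]_(m, n)) : (A - B)^t* = A^t* - B^t*.
Proof. by apply/matrixP => i j; rewrite !mxE rmorphB. Qed.

Lemma adjmxD (m n : nat) (A B : 'M[C]_(m, n)) : (A + B)^t* = A^t* + B^t*.
Proof. by apply/matrixP => i j; rewrite !mxE rmorphD. Qed.

Lemma adjmxN (m n : nat) (A : 'M[C]_(m, n)) : (- A)^t* = - A^t*.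
Proof. by apply/matrixP => i j; rewrite !mxE rmorphN. Qed.

Lemma conj_realC (x : R) : (x%:C)^* = x%:C :> C.
Proof. exact: conjc_real. Qed.

Lemma adjmxZ (m n : nat) (x : R) (A : 'M[C]_(m, n)) :
  (x%:C *: A)^t* = x%:C *: A^t*.
Proof. by apply/matrixP => i j; rewrite !mxE rmorphM/= conj_realC. Qed.

Lemma adjmx_scalar (D : nat) (x : R) : (x%:C%:M : 'M[C]_D)^t* = x%:C%:M.
Proof. by rewrite tr_scalar_mx map_scalar_mx/= conj_realC. Qed.

Lemma gram_hermitian (m n : nat) (A : 'M[C]_(m, n)) :
  (A^t* *m A)^t* = A^t* *m A.
Proof. by rewrite adjmx_mul trmxCK. Qed.

Lemma quad_gram (m n : nat) (A : 'M[C]_(m, n)) u :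
  quad (A^t* *m A) u = sqnorm (u *m A^t*).
Proof.
rewrite /quad mulmxA -mulmxA -[A in A *m u^t*]trmxCK -adjmx_mul.
by rewrite row_mul_adj.
Qed.

(** The spectral theorem for normal matrices, with a diagonal given by real numbers. The rows of V
    are orthonormal eigenvectors. *)
Lemma hermitian_spectral (D : nat) (A : 'M[C]_D) : A^t* = A ->
  exists (V : 'M[C]_D) (r : 'I_D -> R),
    [/\ V *m V^t* = 1%:M, V^t* *m V = 1%:M &
        A = V^t* *m diag_mx (\row_i (r i)%:C) *m V].
Proof.
move=> AA; have Ah : A \is hermsymmx.
  by apply/is_hermitianmxP; rewrite expr0 scale1r AA.
exists (spectralmx A), (fun i => complex.Re (spectral_diag A 0 i)).
have /unitarymxP VV := spectral_unitarymx A.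
split=> //; first exact: mulmx1C.
rewrite (_ : (\row_i _) = spectral_diag A).
  rewrite -invmx_unitary ?spectral_unitarymx//.
  exact/orthomx_spectralP/hermitian_normalmx.
apply/rowP => i; rewrite mxE RRe_real//.
exact: (mxOverP (hermitian_spectral_diag_real Ah)).
Qed.

Lemma quad_spectral (D : nat) (V : 'M[C]_D) (r : 'I_D -> R) u :
  quad (V^t* *m diag_mx (\row_i (r i)%:C) *m V) u =
  \sum_i r i * sqmod ((u *m V^t*) 0 i).
Proof.
set w := u *m V^t*.
have -> : quad (V^t* *m diag_mx (\row_i (r i)%:C) *m V) u =
    quad (diag_mx (\row_i (r i)%:C)) w.
  rewrite /quad [in RHS]/w adjmx_mul trmxCK !mulmxA.
  by rewrite -/w.
rewrite /quad mxE Re_sum; apply: eq_bigr => i _.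
by rewrite mul_mx_diag !mxE mulrAC sqmodE mulrC Re_scale.
Qed.

Lemma sqnorm_unitary (D : nat) (V : 'M[C]_D) u : V^t* *m V = 1%:M ->
  sqnorm (u *m V^t*) = sqnorm u.
Proof.
move=> VV; apply: complexI.
by rewrite -!row_mul_adj// adjmx_mul trmxCK mulmxA -(mulmxA u) VV mulmx1.
Qed.

(** In the coordinates w = u V^*, the eigenvector equation reads r_i w_i = x w_i, and some w_i is
    nonzero. The supremum is thus taken over a finite range. *)
Lemma real_eigenvalues_spectral (D : nat) (V : 'M[C]_D) (r : 'I_D -> R) :
  V *m V^t* = 1%:M -> V^t* *m V = 1%:M ->
  real_eigenvalues (V^t* *m diag_mx (\row_i (r i)%:C) *m V) = range r.
Proof.
move=> VV1 VV2; apply/seteqP; split => x /=; last first.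
  move=> [i _ <-]; apply/eigenvalueP; exists (row i V).
    rewrite -row_mul !mulmxA VV1 mul1mx; apply/rowP => j.
    by rewrite mul_diag_mx !mxE.
  (* A row of V is not zero: V^* maps it to a unit coordinate vector and preserves the norm. *)
  apply/eqP => V0; have := sqnorm_unitary (row i V) VV2.
  rewrite -row_mul VV1 V0 /sqnorm (bigD1 i)//= [X in _ = X]big1; last first.
    by move=> j _; rewrite mxE /sqmod /= expr0n/= addr0.
  rewrite !mxE eqxx /= {1}/sqmod /= => /eqP; rewrite paddr_eq0.
  - by rewrite expr1n expr0n/= addr0 oner_eq0.
  - by rewrite addr_ge0 ?sqr_ge0.
  - by apply: sumr_ge0 => j _; exact: sqmod_ge0.
move=> /eigenvalueP[u ux u0].
have wx : u *m V^t* *m diag_mx (\row_i (r i)%:C) = x%:C *: (u *m V^t*).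
  by rewrite scalemxAl -ux !mulmxA -[RHS]mulmxA VV1 mulmx1.
have w0 : u *m V^t* != 0.
  apply: contra u0 => /eqP w0.
  by rewrite -[u]mulmx1 -VV2 mulmxA w0 mul0mx.
have [i wi] : exists i, (u *m V^t*) 0 i != 0.
  apply/existsP; apply: contraNT w0 => /existsPn w0.
  by apply/eqP/rowP => i; rewrite [RHS]mxE; apply/eqP; rewrite -[_ == _]negbK w0.
exists i => //; apply: complexI; apply: (mulfI wi).
by move/rowP/(_ i): wx; rewrite mul_mx_diag !mxE => ->; rewrite mulrC.
Qed.

Lemma lambda_max_argmax (D : nat) (V : 'M[C]_D) (r : 'I_D -> R) : (0 < D)%N ->
  V *m V^t* = 1%:M -> V^t* *m V = 1%:M ->
  exists2 i, lambda_max (V^t* *m diag_mx (\row_i (r i)%:C) *m V) = r i &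
    forall j, r j <= r i.
Proof.
move=> D0 VV1 VV2; rewrite /lambda_max real_eigenvalues_spectral//.
pose i0 := Ordinal D0.
have [i _ ri] := @Order.TotalTheory.arg_maxP _ _ _ i0 xpredT r isT.
exists i => [|j]; last exact: ri.
apply/eqP; rewrite eq_le; apply/andP; split.
  by apply: ge_sup; [exists (r i), i|move=> _ [j _ <-]; exact: ri].
by apply: ub_le_sup; [exists (r i) => _ [j _ <-]; exact: ri|exists i].
Qed.

Lemma eigenvalue_lambda_max (D : nat) (A : 'M[C]_D) : (0 < D)%N -> A^t* = A ->
  eigenvalue A (lambda_max A)%:C.
Proof.
move=> D0 /hermitian_spectral[V [r [VV1 VV2 ->]]].
have [i -> _] := lambda_max_argmax r D0 VV1 VV2.
have : range r (r i) by exists i.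
by rewrite -(real_eigenvalues_spectral r VV1 VV2).
Qed.

Lemma le_lambda_max (D : nat) (A : 'M[C]_D) (x : R) : A^t* = A ->
  eigenvalue A x%:C -> x <= lambda_max A.
Proof.
have [D0|D0] := posnP D.
  by move: A; rewrite D0 => A _ /eigenvalueP[u _]; rewrite [u]thinmx0 eqxx.
move=> /hermitian_spectral[V [r [VV1 VV2 ->]]].
have [i -> ri] := lambda_max_argmax r D0 VV1 VV2.
by move=> /[dup] xe; have := real_eigenvalues_spectral r VV1 VV2
  => /seteqP[/(_ x xe)[j _ <-]].
Qed.

(** In spectral coordinates the form is a sum of eigenvalues with nonnegative weights of total
    [sqnorm u]. *)
Lemma quad_le (D : nat) (A : 'M[C]_D) u : A^t* = A ->
  quad A u <= lambda_max A * sqnorm u.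
Proof.
have [D0|D0] := posnP D.
  move=> _; rewrite /quad /sqnorm; subst D.
  by rewrite big_ord0 mulr0 mxE big_ord0.
move=> /hermitian_spectral[V [r [VV1 VV2 ->]]].
rewrite quad_spectral -(sqnorm_unitary u VV2) mulr_sumr.
have [i -> ri] := lambda_max_argmax r D0 VV1 VV2.
by apply: ler_sum => j _; rewrite ler_wpM2r ?sqmod_ge0.
Qed.

(** Weyl's inequality for the largest eigenvalue: at a top eigenvector of A + B, the quadratic form
    splits into two forms, each bounded by [quad_le]. *)
Lemma lambda_maxD (D : nat) (A B : 'M[C]_D) : (0 < D)%N ->
  A^t* = A -> B^t* = B -> lambda_max (A + B) <= lambda_max A + lambda_max B.
Proof.
move=> D0 AA BB; have AB : (A + B)^t* = A + B by rewrite adjmxD AA BB.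
have /eigenvalueP[u /quad_eigen quA u0] := eigenvalue_lambda_max D0 AB.
rewrite -(ler_pM2r (sqnorm_gt0 u0)) -quA quadD mulrDl.
by rewrite lerD ?quad_le.
Qed.

(** Reduces the smallest eigenvalue to the largest; [inf] is itself defined through [sup] of the
    opposite set. *)
Lemma lambda_minE (D : nat) (A : 'M[C]_D) : lambda_min A = - lambda_max (- A).
Proof.
rewrite /lambda_min /lambda_max /inf; congr (- sup _).
apply/seteqP; split => x /=.
  move=> [y /eigenvalueP[u ux u0] <-]; apply/eigenvalueP; exists u => //.
  by rewrite mulmxN ux rmorphN scaleNr.
move=> /eigenvalueP[u ux u0]; exists (- x); last by rewrite opprK.
by apply/eigenvalueP; exists u => //; rewrite rmorphN scaleNr -ux mulmxN opprK.
Qed.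

Lemma eigenvalue_lambda_min (D : nat) (A : 'M[C]_D) : (0 < D)%N -> A^t* = A ->
  eigenvalue A (lambda_min A)%:C.
Proof.
move=> D0 AA; have NA : (- A)^t* = - A by rewrite adjmxN AA.
have /eigenvalueP[u ux u0] := eigenvalue_lambda_max D0 NA.
apply/eigenvalueP; exists u => //.
by rewrite lambda_minE rmorphN scaleNr -ux mulmxN opprK.
Qed.

Lemma lambda_min_le_max (D : nat) (A : 'M[C]_D) : (0 < D)%N -> A^t* = A ->
  lambda_min A <= lambda_max A.
Proof. by move=> D0 AA; apply: le_lambda_max => //; exact: eigenvalue_lambda_min. Qed.

Lemma lambda_min_le (D : nat) (A : 'M[C]_D) (x : R) : A^t* = A ->
  eigenvalue A x%:C -> lambda_min A <= x.
Proof.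
move=> AA /eigenvalueP[u ux u0]; rewrite lambda_minE lerNl.
apply: le_lambda_max; first by rewrite adjmxN AA.
by apply/eigenvalueP; exists u => //; rewrite mulmxN ux rmorphN scaleNr.
Qed.

Lemma lambda_min_gram_ge0 (m D : nat) (A : 'M[C]_(m, D)) : (0 < D)%N ->
  0 <= lambda_min (A^t* *m A).
Proof.
move=> D0.
have /eigenvalueP[u ux u0] := eigenvalue_lambda_min D0 (gram_hermitian A).
rewrite -(pmulr_lge0 _ (sqnorm_gt0 u0)) -(quad_eigen ux) quad_gram.
exact: sqnorm_ge0.
Qed.

(** Since A^* A is the square of A, x ^ 2 is one of its eigenvalues. *)
Lemma eigenvalue_le_opnorm (D : nat) (A : 'M[C]_D) (x : R) : A^t* = A ->
  eigenvalue A x%:C -> `|x| <= opnorm A.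
Proof.
move=> AA /eigenvalueP[u ux u0]; rewrite -sqrtr_sqr ler_wsqrtr//.
apply: le_lambda_max; first exact: gram_hermitian.
apply/eigenvalueP; exists u => //.
by rewrite AA mulmxA ux -scalemxAl ux scalerA -rmorphM expr2.
Qed.

(** The trace of A^* A is both the squared Frobenius norm and the sum of the eigenvalues; as these
    are nonnegative, the largest is at most the sum. *)
Lemma opnorm_le_frobenius (m D : nat) (A : 'M[C]_(m, D)) : (0 < D)%N ->
  opnorm A <= Num.sqrt (\sum_i \sum_j sqmod (A i j)).
Proof.
move=> D0; rewrite ler_wsqrtr//.
have trA : \tr (A^t* *m A) = (\sum_i \sum_j sqmod (A i j))%:C.
  rewrite mxtrace_mulC rmorph_sum/=; apply: eq_bigr => i _.
  rewrite mxE rmorph_sum/=; apply: eq_bigr => j _.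
  by rewrite !mxE sqmodE.
have := lambda_min_gram_ge0 A D0.
have [V [r [VV1 VV2 E]]] := hermitian_spectral (gram_hermitian A).
have rE : \sum_i r i = \sum_i \sum_j sqmod (A i j).
  apply: complexI; rewrite -trA E -mulmxA mxtrace_mulC -mulmxA VV1 mulmx1.
  by rewrite mxtrace_diag rmorph_sum/=; apply: eq_bigr => i _; rewrite mxE.
move=> min0.
have r0 j : 0 <= r j.
  apply: (le_trans min0); apply: lambda_min_le; first exact: gram_hermitian.
  have : range r (r j) by exists j.
  by rewrite -(real_eigenvalues_spectral r VV1 VV2) /= -E.
rewrite E; have [i -> _] := lambda_max_argmax r D0 VV1 VV2.
by rewrite -rE (bigD1 i)//= lerDl sumr_ge0.
Qed.

Lemma eigenvalueZ (D : nat) (A : 'M[C]_D) (c x : R) : c != 0 ->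
  eigenvalue (c%:C *: A) (c * x)%:C = eigenvalue A x%:C.
Proof.
move=> c0; have c0' : c%:C != 0 :> C by rewrite eq_complex /= eqxx andbT.
apply/eigenvalueP/eigenvalueP => -[u ux u0]; exists u => //; last first.
  by rewrite -scalemxAr ux scalerA -rmorphM.
by apply: (scalerI c0'); rewrite scalerA -rmorphM -ux scalemxAr.
Qed.

Lemma lambda_maxZ (D : nat) (A : 'M[C]_D) (c : R) : (0 < D)%N -> A^t* = A ->
  0 < c -> lambda_max (c%:C *: A) = c * lambda_max A.
Proof.
move=> D0 AA c0; have cA : (c%:C *: A)^t* = c%:C *: A by rewrite adjmxZ AA.
apply/eqP; rewrite eq_le; apply/andP; split; last first.
  by apply: le_lambda_max => //; rewrite eigenvalueZ ?gt_eqF// eigenvalue_lambda_max.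
rewrite mulrC -ler_pdivrMr//; apply: le_lambda_max => //.
rewrite -(eigenvalueZ _ _ (lt0r_neq0 c0)) mulrC divfK ?gt_eqF//.
exact: eigenvalue_lambda_max.
Qed.

Lemma lambda_minZ (D : nat) (A : 'M[C]_D) (c : R) : (0 < D)%N -> A^t* = A ->
  0 < c -> lambda_min (c%:C *: A) = c * lambda_min A.
Proof.
move=> D0 AA c0; rewrite !lambda_minE -scalerN lambda_maxZ ?mulrN//.
by rewrite adjmxN AA.
Qed.

Lemma unitmx_eigenvalue0 (D : nat) (A : 'M[C]_D) :
  (A \in unitmx) = ~~ eigenvalue A 0.
Proof.
by rewrite unitmxE unitfE eigenvalue_root_char rootE horner_coef0
  char_poly_det mulf_eq0 signr_eq0.
Qed.

Lemma lambda_min_gram_gt0 (m D : nat) (A : 'M[C]_(m, D)) : (0 < D)%N ->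
  A^t* *m A \in unitmx -> 0 < lambda_min (A^t* *m A).
Proof.
move=> D0; rewrite unitmx_eigenvalue0 lt_neqAle lambda_min_gram_ge0// andbT.
apply: contra => /eqP E0.
by have := eigenvalue_lambda_min D0 (gram_hermitian A); rewrite -E0.
Qed.

Lemma lambda_min_gt0_unitmx (D : nat) (A : 'M[C]_D) : A^t* = A ->
  0 < lambda_min A -> A \in unitmx.
Proof.
move=> AA A0; rewrite unitmx_eigenvalue0; apply: contraTN A0 => e0.
by rewrite -leNgt; apply: lambda_min_le.
Qed.

(** For a row eigenvector u, the number u A u^* equals both z |u|^2 and its conjugate. This is
    needed because the characteristic polynomial is split over the complex numbers. *)
Lemma eigenvalue_hermitian_real (D : nat) (A : 'M[C]_D) (z : C) : A^t* = A ->
  eigenvalue A z -> z = (complex.Re z)%:C.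
Proof.
move=> AA /eigenvalueP[u uz u0]; apply/esym/RRe_real/CrealP.
have n0 : (sqnorm u)%:C != 0 :> C.
  by rewrite eq_complex /= eqxx andbT gt_eqF ?sqnorm_gt0.
apply: (mulIf n0); rewrite -row_mul_adj.
transitivity ((u *m A *m u^t*) 0 0); last by rewrite uz -scalemxAl mxE.
rewrite -mulmxA -[A in RHS]AA -adjmx_mul uz !mxE mulr_sumr.
by apply: eq_bigr => i _; rewrite !mxE rmorphM mulrCA.
Qed.

(* The roots of the monic polynomial are all nonpositive if and only if its
   coefficients are all nonnegative. *)
Lemma lambda_max_le_coef_char_poly (D : nat) (A : 'M[C]_D) (c : R) :
  (0 < D)%N -> A^t* = A ->
  lambda_max A <= c <->
  forall i, 0 <= complex.Re (char_poly (A - c%:C%:M))`_i.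
Proof.
move=> D0 AA; set B := A - _.
have BB : B^t* = B by rewrite adjmxB AA adjmx_scalar.
have eB x : eigenvalue B x%:C = eigenvalue A (x + c)%:C.
  apply/eigenvalueP/eigenvalueP => -[u ux u0]; exists u => //.
    by rewrite rmorphD scalerDl -ux mulmxBr mul_mx_scalar subrK.
  by rewrite mulmxBr ux mul_mx_scalar rmorphD scalerDl addrK.
split=> [Ac i|coef0].
  have Ble0 (z : C) : eigenvalue B z -> z <= 0.
    move=> zB; have zE := eigenvalue_hermitian_real BB zB.
    have zA : eigenvalue A (complex.Re z + c)%:C by rewrite -eB; case: _ / zE.
    have Rez0 : complex.Re z <= 0.
      by rewrite -(lerD2r c) add0r (le_trans (le_lambda_max AA zA)).
    by rewrite zE (_ : 0 = 0%:C) ?lecR.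
  suff : forall k, 0 <= (char_poly B)`_k.
    by move=> /(_ i); rewrite lecE => /andP[].
  have [rs Brs] := closed_field_poly_normal (char_poly B).
  move: Brs; rewrite (monicP (char_poly_monic B)) scale1r => Brs.
  have rs0 z : z \in rs -> z <= 0.
    by move=> zrs; rewrite Ble0// eigenvalue_root_char Brs root_prod_XsubC.
  (* Each factor X - z with z <= 0 has nonnegative coefficients, hence so has the product. *)
  rewrite Brs big_seq; elim/big_rec: _ => [|z p /rs0 z0 IH] k.
    by rewrite coef1 ler0n.
  rewrite mulrBl coefB coefXM coefCM -mulNr addr_ge0//.
    by case: ifP.
  by rewrite mulr_ge0// oppr_ge0.
(* Conversely, at a root x > 0 the leading term x ^ D is positive and the other terms have
   nonnegative real part, so the value cannot vanish. *)
rewrite leNgt; apply/negP => cA.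
have : eigenvalue B (lambda_max A - c)%:C.
  by rewrite eB subrK eigenvalue_lambda_max.
set x := lambda_max A - c; have x0 : 0 < x by rewrite subr_gt0.
rewrite eigenvalue_root_char => /rootP; rewrite horner_coef size_char_poly.
move/(congr1 (@complex.Re R)); rewrite Re_sum big_ord_recr /= => /eqP.
have ReX k z : complex.Re (z * x%:C ^+ k) = x ^+ k * complex.Re z.
  by rewrite mulrC -rmorphXn Re_scale.
have lead : (char_poly B)`_D = 1.
  by have /monicP := char_poly_monic B; rewrite lead_coefE size_char_poly.
rewrite gt_eqF// ReX lead mulr1 addrC ltr_pwDl ?exprn_gt0//.
by apply: sumr_ge0 => k _; rewrite ReX mulr_ge0// exprn_ge0// ltW.
Qed.
End hermitian_matrices.

(** * Independence and expectations of products *)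

Section measurable_comparison.
Context {d : measure_display} {T : measurableType d} {R : realType}.

Lemma measurable_ltr_set (f g : T -> R) : measurable_fun setT f ->
  measurable_fun setT g -> measurable [set w | f w < g w].
Proof.
move=> mf mg; have : measurable_fun setT (fun w => f w < g w).
  exact: measurable_fun_ltr.
by move=> /(_ measurableT [set true]); rewrite setTI; exact.
Qed.

Lemma measurable_ler_set (f g : T -> R) : measurable_fun setT f ->
  measurable_fun setT g -> measurable [set w | f w <= g w].
Proof.
move=> mf mg; have : measurable_fun setT (fun w => f w <= g w).
  exact: measurable_fun_ler.
by move=> /(_ measurableT [set true]); rewrite setTI; exact.
Qed.

End measurable_comparison.

Section independence.
Context {d : measure_display} {T : measurableType d} {R : realType}.
Variable P : probability T R.
Local Open Scope ereal_scope.

(* The layer-cake formula for Y, integrated against the density W. *)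
Lemma ge0_integralM_layer_cake (W Y : T -> R) :
  measurable_fun setT W -> measurable_fun setT Y ->
  (forall w, 0 <= W w)%R -> (forall w, 0 <= Y w)%R ->
  \int[P]_w (W w * Y w)%:E =
  \int[@lebesgue_measure R]_(s in `[0%R, +oo[)
     \int[P]_w (W w * \1_[set w | (s < Y w)%R] w)%:E.
Proof.
move=> mW mY W0 Y0;
pose f (z : T * measurableTypeR R) : \bar R := (W z.1 * \1_`[0%R, Y z.1[%classic z.2)%:E.
have f0 z : 0 <= f z by rewrite lee_fin mulr_ge0.
have mf : measurable_fun setT f.
  apply/measurable_EFinP/measurable_funM; first exact: measurableT_comp.
  pose A : set (T * measurableTypeR R) := [set z | (0 <= z.2 < Y z.1)%R].
  rewrite (_ : (fun z : T * measurableTypeR R => _) = \1_A); last first.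
    by apply/funext => z; rewrite !indicE /A; congr ((_ : bool)%:R);
      apply/idP/idP; rewrite !inE/= in_itv.
  apply: measurable_indic.
  rewrite (_ : A = [set z : T * measurableTypeR R | (0 <= z.2)%R] `&`
      [set z | (z.2 < Y z.1)%R]); last first.
    by apply/seteqP; split => z /= => [/andP//|[? ?]]; exact/andP.
  apply: measurableI; first exact: measurable_ler_set.
  by apply: measurable_ltr_set => //; exact: measurableT_comp.
transitivity (\int[P]_w \int[@lebesgue_measure R]_s f (w, s)).
  apply: eq_integral => w _; rewrite /f /=.
  under eq_integral do rewrite EFinM.
  rewrite ge0_integralZl_EFin//; last first.
    by apply/measurable_EFinP/measurable_indic.
  rewrite integral_indic// setIT EFinM; congr (_ * _); apply/esym.
  transitivity (@lebesgue_measure R `[0%R, Y w[%classic) => //.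
  rewrite lebesgue_measure_itv/= lte_fin.
  have [_|Yle] := ltP 0%R (Y w); first by rewrite sube0.
  by congr _%:E; apply/eqP; rewrite eq_le Yle Y0.
transitivity (\int[@lebesgue_measure R]_s \int[P]_w f (w, s)).
  exact: (@fubini_tonelli _ _ T (measurableTypeR R) R P (@lebesgue_measure R) f mf f0).
rewrite [RHS]integral_mkcond; apply: eq_integral => s _.
rewrite patchE; case: ifPn => [|]; rewrite ?notin_setE ?inE/= in_itv/= andbT.
  move=> s0; apply: eq_integral => w _; rewrite /f /=; congr (_ * _)%:E.
  by rewrite !indicE; congr ((_ : bool)%:R); apply/idP/idP;
     rewrite !inE/= in_itv/= s0.
move=> s0; apply: integral0_eq => w _; rewrite /f /= indicE memNset ?mulr0//.
by rewrite /= in_itv/= => /andP[].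
Qed.

(** A product rule for the indicators of the sets s < Y extends to Y by integration over s. In the
    application, c is the factorised expectation of W. *)
Lemma integralM_indep (W Y : T -> R) (c : \bar R) :
  measurable_fun setT W -> measurable_fun setT Y ->
  (forall w, 0 <= W w)%R -> (forall w, 0 <= Y w)%R -> 0 <= c ->
  (forall s : R, \int[P]_w (W w * \1_[set w | (s < Y w)%R] w)%:E =
     c * P [set w | (s < Y w)%R]) ->
  \int[P]_w (W w * Y w)%:E = c * \int[P]_w (Y w)%:E.
Proof.
move=> mW mY W0 Y0 c0 WY.
have mP : measurable_fun setT (fun s : R => P [set w | (s < Y w)%R]).
  pose X := mfun_Sub (mem_set mY : Y \in mfun).
  apply: (eq_measurable_fun (ccdf (X : {RV P >-> R}))).
    move=> s _; rewrite /ccdf /distribution /pushforward; congr (P _).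
    by apply/seteqP; split => w /=; rewrite in_itv/= andbT.
  exact: ccdf_measurable.
have YE : \int[P]_w (Y w)%:E =
    \int[@lebesgue_measure R]_(s in `[0%R, +oo[) P [set w | (s < Y w)%R].
  transitivity (\int[P]_w (1 * Y w)%:E).
    by apply: eq_integral => w _; rewrite mul1r.
  rewrite (@ge0_integralM_layer_cake (cst 1%R))//.
  apply: eq_integral => s _ /=.
  under eq_integral do rewrite mul1r.
  by rewrite integral_indic ?setIT//; exact: measurable_ltr_set.
rewrite ge0_integralM_layer_cake// YE -ge0_integralZl//.
  by apply: eq_integral.
exact: measurable_funTS.
Qed.

Lemma prod_indic (n : nat) (A : 'I_n -> set T) w :
  (\prod_t \1_(A t) w = \1_[set w | forall t, A t w] w :> R)%R.
Proof.
have [Aw|Aw] := pselect (forall t, A t w).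
  by rewrite big1 => [|t _]; rewrite indicE mem_set.
have [t Atw] : exists t, ~ A t w by exact/existsNP.
by rewrite (bigD1 t)//= indicE memNset// mul0r indicE memNset.
Qed.

(** Induction on the number k of factors that are the functions [Y t]; the remaining ones are
    indicators of the sets s t < Y t. For k = 0 this is the hypothesis on events. The thresholds s
    stay arbitrary because the inductive step changes one of them. *)
Lemma expectation_prod_indep (n : nat) (Y : 'I_n -> T -> R) :
  (forall t, measurable_fun setT (Y t)) -> (forall t w, 0 <= Y t w)%R ->
  (forall s : 'I_n -> R, P [set w | forall t, (s t < Y t w)%R] =
     \prod_t P [set w | (s t < Y t w)%R]) ->
  \int[P]_w (\prod_t Y t w)%:E = \prod_t \int[P]_w (Y t w)%:E.
Proof.
move=> mY Y0 YY.
pose Z (k : nat) (s : 'I_n -> R) (t : 'I_n) (w : T) : R :=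
  if (t < k)%N then Y t w else \1_[set w | (s t < Y t w)%R] w.
have Z0 k s t w : (0 <= Z k s t w)%R by rewrite /Z; case: ifP.
have mZ k s t : measurable_fun setT (Z k s t).
  rewrite /Z; case: (t < k)%N => //.
  by apply: measurable_indic; exact: measurable_ltr_set.
have ZE k s : (k <= n)%N ->
    \int[P]_w (\prod_t Z k s t w)%:E = \prod_t \int[P]_w (Z k s t w)%:E.
  elim: k s => [s _|k IH s kn].
    under eq_integral do rewrite prod_indic.
    rewrite integral_indic//; last first.
      rewrite (_ : [set w | _] = \bigcap_(t in [set: 'I_n])
          [set w | (s t < Y t w)%R]); last first.
        by apply/seteqP; split => w /= sY t; [move=> _|]; exact: sY.
      apply: fin_bigcap_measurable => // t _; exact: measurable_ltr_set.
    rewrite setIT; transitivity (P [set w | forall t, (s t < Y t w)%R]) => //.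
    rewrite YY; apply: eq_bigr => t _.
    by rewrite integral_indic ?setIT//; exact: measurable_ltr_set.
  pose t0 := Ordinal kn.
  pose W w := (\prod_(t | t != t0) Z k s t w)%R.
  have ZS t w : t != t0 -> Z k.+1 s t w = Z k s t w.
    by move=> tt0; rewrite /Z ltnS leq_eqVlt (negbTE (tt0 : val t != k)).
  have Zt0 w : Z k.+1 s t0 w = Y t0 w by rewrite /Z ltnSn.
  under eq_integral.
    move=> w _; rewrite (bigD1 t0)//= Zt0 mulrC (eq_bigr (fun t => Z k s t w)).
      over.
    by move=> t; exact: ZS.
  rewrite (@integralM_indep W (Y t0) (\prod_(t | t != t0) \int[P]_w (Z k s t w)%:E))//.
  - rewrite [RHS](bigD1 t0)//= muleC; congr (_ * _).
      by apply: eq_integral => w _; rewrite Zt0.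
    by apply: eq_bigr => t tt0; apply: eq_integral => w _; rewrite ZS.
  - rewrite (_ : W = fun w => (\prod_t (if t != t0 then Z k s t w else 1))%R).
      by apply: measurable_prod => t _; case: (t != t0).
    by apply/funext => w; rewrite /W big_mkcond.
  - by move=> w; apply: prodr_ge0.
  - by apply: prode_ge0 => t _; apply: integral_ge0 => w _; rewrite lee_fin.
  (* Moving the threshold of index [t0] to x turns the required identity into the induction
     hypothesis. *)
  - move=> x; pose s' t := if t == t0 then x else s t.
    have Zs' t w : t != t0 -> Z k s' t w = Z k s t w.
      by move=> /negbTE tt0; rewrite /Z /s' tt0.
    have Zs't0 w : Z k s' t0 w = \1_[set w | (x < Y t0 w)%R] w.
      by rewrite /Z /s' ltnn eqxx.
    transitivity (\int[P]_w (\prod_t Z k s' t w)%:E).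
      apply: eq_integral => w _; rewrite (bigD1 t0)//= mulrC Zs't0.
      by congr (_ * _)%:E; apply: eq_bigr => t tt0; rewrite Zs'.
    rewrite IH ?(ltnW kn)// (bigD1 t0)//= muleC; congr (_ * _).
      by apply: eq_bigr => t tt0; apply: eq_integral => w _; rewrite Zs'.
    under eq_integral do rewrite Zs't0.
    by rewrite integral_indic ?setIT//; exact: measurable_ltr_set.
transitivity (\int[P]_w (\prod_t Z n (cst 0%R) t w)%:E).
  by apply: eq_integral => w _; congr _%:E; apply: eq_bigr => t _; rewrite /Z ltn_ord.
rewrite ZE//; apply: eq_bigr => t _.
by apply: eq_integral => w _; rewrite /Z ltn_ord.
Qed.

End independence.

(** * Bernstein's inequality *)

Section bernstein.
Context {d : measure_display} {T : measurableType d} {R : realType}.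
Variable P : probability T R.
Local Open Scope ereal_scope.

Lemma integral_cst_probability (c : \bar R) : \int[P]_w cst c w = c.
Proof.
rewrite integral_cst//; transitivity (c * 1); last exact: mule1.
congr (_ * _); exact: probability_setT.
Qed.

(** The exponential series without its first two terms, in absolute values. The sum is an extended
    real with nonnegative terms, so that it can be integrated term by term without a convergence
    condition. *)
Lemma expR_sub1_le_nneseries (y : R) :
  (expR y - 1 - y)%:E <= \sum_(l <oo) (`|y| ^+ l.+2 / (l.+2)`!%:R)%:E.
Proof.
pose u (l : nat) : \bar R := (`|y| ^+ l.+2 / (l.+2)`!%:R)%:E.
rewrite -[X in _ <= X]/(\sum_(l <oo) u l).
have u0 l : 0 <= u l by rewrite lee_fin divr_ge0.
have Sge N : \sum_(0 <= l < N) u l <= \sum_(l <oo) u l.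
  exact: nneseries_lim_ge.
case: (\sum_(l <oo) u l) Sge => [r Sge| |Sge]; rewrite ?leey//; last first.
  by have := Sge 0%N; rewrite big_geq.
rewrite lee_fin -addrA -opprD lerBlDr -[expR y]/(limn (series (exp_coeff y))).
apply: limr_le; first exact: is_cvg_series_exp_coeff.
near=> n; have [k ->] : exists k, n = k.+2.
  have n2 : (2 <= n)%N by near: n; exact: nbhs_infty_ge.
  by exists (n - 2)%N; rewrite -addn2 subnK.
rewrite /series /= big_nat_recl// big_nat_recl//= /exp_coeff /=.
rewrite !expr0 expr1 fact0 factS fact0 !divr1 addrA [leRHS]addrC lerD2l.
rewrite -lee_fin; apply: le_trans (Sge k); rewrite -sumEFin.
apply: lee_sum => l _; rewrite lee_fin ler_wpM2r//.
by rewrite -normrX ler_norm.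
Unshelve. all: by end_near. Qed.

Variables (X : T -> R) (M v : R).
Hypotheses (mX : measurable_fun setT X) (M0 : (0 <= M)%R) (v0 : (0 <= v)%R).
Hypothesis iX : P.-integrable setT (EFin \o X).
Hypothesis EX : \int[P]_w (X w)%:E = 0.
Hypothesis momX : forall l, (2 <= l)%N ->
  \int[P]_w (`|X w| ^+ l)%:E <= (2^-1 * (l`!)%:R * M ^+ (l - 2) * v)%:E.

(** In term l, the factorial cancels against the one in the moment bound of order l + 2, which
    leaves a q ^ l with a = lam ^ 2 v / 2 and q = lam M; the geometric series sums to a / (1 -
    q). *)
Lemma integral_expR_remainder_le (lam : R) : (0 <= lam)%R -> (lam * M < 1)%R ->
  \int[P]_w (expR (lam * X w) - 1 - lam * X w)%:E <=
  (lam ^+ 2 * v / (2 * (1 - lam * M)))%:E.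
Proof.
move=> lam0 lamM.
have mlX : measurable_fun setT (fun w => lam * X w)%R.
  exact: measurable_funM.
pose u (l : nat) (w : T) : \bar R := (`|lam * X w| ^+ l.+2 / (l.+2)`!%:R)%:E.
have u0 l w : 0 <= u l w by rewrite lee_fin divr_ge0.
have mu l : measurable_fun setT (u l).
  apply/measurable_EFinP/measurable_funM => //.
  by apply: measurable_funX; exact: measurableT_comp.
apply: (@le_trans _ _ (\int[P]_w (\sum_(l <oo) u l w))).
  apply: ge0_le_integral => //.
  - by move=> w _; rewrite lee_fin subr_ge0 lerBrDl expR_ge1Dx.
  - apply/measurable_EFinP/measurable_funB => //; apply/measurable_funB => //.
    exact: measurableT_comp.
  - by apply: ge0_emeasurable_sum.
  - by move=> w _; exact: expR_sub1_le_nneseries.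
rewrite integral_nneseries//.
pose a := (lam ^+ 2 * v / 2)%R; pose q := (lam * M)%R.
have a0 : (0 <= a)%R by rewrite divr_ge0// mulr_ge0// exprn_ge0.
have q0 : (0 <= q)%R by rewrite mulr_ge0.
have uE l : \int[P]_w u l w <= (a * q ^+ l)%:E.
  rewrite (eq_integral (fun w => (`|lam| ^+ l.+2 / (l.+2)`!%:R)%:E *
      (`|X w| ^+ l.+2)%:E)); last first.
    by move=> w _; rewrite /u normrM exprMn mulrAC EFinM.
  rewrite ge0_integralZl_EFin//; last first.
    by apply/measurable_EFinP; apply: measurable_funX; exact: measurableT_comp.
  apply: le_trans (lee_wpmul2l _ (momX (isT : 2 <= l.+2)%N)) _.
    by rewrite lee_fin divr_ge0// exprn_ge0.
  rewrite -EFinM lee_fin (ger0_norm lam0) subSS subn1 /=.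
  have f0 : ((l.+2)`!%:R != 0 :> R)%R by rewrite pnatr_eq0 -lt0n fact_gt0.
  rewrite /a /q exprMn -addn2 exprD le_eqVlt; apply/orP; left; apply/eqP.
  by rewrite addn2; field.
apply: (@le_trans _ _ (\sum_(l <oo) (a * q ^+ l)%:E)).
  by apply: lee_nneseries => // l _ _; apply: integral_ge0.
have -> : (lam ^+ 2 * v / (2 * (1 - lam * M)) = a / (1 - q))%R.
  by rewrite /a /q invfM mulrA.
apply: lime_le.
  by apply: is_cvg_nneseries => l _ _; rewrite lee_fin mulr_ge0// exprn_ge0.
apply: nearW => k; rewrite sumEFin lee_fin.
have q1 : q != 1%R by rewrite lt_eqF.
have := congr1 (fun f => f k) (geometric_seriesE a q1).
rewrite /series /= => ->; rewrite ler_wpM2r ?invr_ge0 ?subr_ge0 ?(ltW lamM)//.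
by rewrite ler_piMr// gerBl exprn_ge0.
Qed.

(** As X is centered, the integral is 1 plus that of the remainder, and 1 + b <= exp b.
    Integrability of the exponential also comes from the remainder. *)
Lemma integral_expR_le (lam : R) : (0 <= lam)%R -> (lam * M < 1)%R ->
  \int[P]_w (expR (lam * X w))%:E <=
  (expR (lam ^+ 2 * v / (2 * (1 - lam * M))))%:E.
Proof.
move=> lam0 lamM.
pose G w := (expR (lam * X w) - 1 - lam * X w)%R.
have G0 w : (0 <= G w)%R by rewrite subr_ge0 lerBrDl expR_ge1Dx.
have mlX : measurable_fun setT (fun w => lam * X w)%R by exact: measurable_funM.
have mG : measurable_fun setT G.
  by apply: measurable_funB => //; apply/measurable_funB => //; exact: measurableT_comp.
have Gle := integral_expR_remainder_le lam0 lamM.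
have iG : P.-integrable setT (EFin \o G).
  apply/integrableP; split; first exact/measurable_EFinP.
  under eq_integral do rewrite /= ger0_norm//.
  exact: le_lt_trans Gle (ltry _).
have ilX : P.-integrable setT (fun w => lam%:E * (EFin \o X) w).
  exact: integrableZl.
have i1 : P.-integrable setT (EFin \o cst 1%R).
  exact: finite_measure_integrable_cst.
have -> : \int[P]_w (expR (lam * X w))%:E = 1 + \int[P]_w (G w)%:E.
  transitivity (\int[P]_w (((EFin \o cst 1%R) w + lam%:E * (EFin \o X) w) +
      (EFin \o G) w)).
    by apply: eq_integral => w _ /=; rewrite -EFinM -!EFinD /G; congr _%:E; ring.
  rewrite integralD//; last exact: integrableD.
  rewrite integralD// integralZl// EX mule0 adde0.
  congr (_ + _); transitivity (\int[P]_w cst 1 w); first exact: eq_integral.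
  exact: integral_cst_probability.
apply: le_trans (leeD2l 1 Gle) _.
by rewrite -EFinD lee_fin expR_ge1Dx.
Qed.

End bernstein.

(** * Tail bounds for sums of independent copies *)

Section bernstein_iid.
Context {d : measure_display} {T : measurableType d} {R : realType}.
Variable P : probability T R.
Local Open Scope ereal_scope.

Lemma integral_comp_eq (X Y : T -> R) (f : R -> R) :
  measurable_fun setT X -> measurable_fun setT Y -> measurable_fun setT f ->
  (forall r, 0 <= f r)%R ->
  (forall B : set R, measurable B -> P (X @^-1` B) = P (Y @^-1` B)) ->
  \int[P]_w (f (X w))%:E = \int[P]_w (f (Y w))%:E.
Proof.
move=> mX mY mf f0 XY.
have push (Z : T -> R) (mZ : measurable_fun setT Z) :
    \int[P]_w (f (Z w))%:E = \int[pushforward P Z]_r (f r)%:E.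
  rewrite ge0_integral_pushforward//; first exact/measurable_EFinP.
  by move=> r _; rewrite lee_fin.
rewrite !push//; apply: eq_measure_integral => B mB _.
exact: XY.
Qed.

Lemma prode_le_expe (n : nat) (f : 'I_n -> \bar R) (c : R) :
  (forall t, 0 <= f t) -> (forall t, f t <= c%:E) ->
  \prod_t f t <= (c ^+ n)%:E.
Proof.
move=> f0 fc.
have fE t : f t = (fine (f t))%:E.
  by rewrite fineK// ge0_fin_numE// (le_lt_trans (fc t)) ?ltry.
rewrite (eq_bigr (fun t => (fine (f t))%:E)) => [|t _]; last exact: fE.
rewrite prodEFin lee_fin (_ : c ^+ n = \prod_(t < n) c)%R; last first.
  by rewrite prodr_const card_ord.
by apply: ler_prod => t _; rewrite fine_ge0//= -lee_fin -fE fc.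
Qed.

Variables (n : nat) (X : 'I_n -> T -> R) (t0 : 'I_n) (M v : R).
Hypotheses (mX : forall t, measurable_fun setT (X t)).
Hypothesis indepX : forall B : 'I_n -> set R, (forall t, measurable (B t)) ->
  P [set w | forall t, B t (X t w)] = \prod_t P [set w | B t (X t w)].
Hypothesis idX : forall t (B : set R), measurable B ->
  P (X t @^-1` B) = P (X t0 @^-1` B).
Hypotheses (M0 : (0 <= M)%R) (v0 : (0 <= v)%R).
Hypothesis iX : P.-integrable setT (EFin \o X t0).
Hypothesis EX : \int[P]_w (X t0 w)%:E = 0.
Hypothesis momX : forall l, (2 <= l)%N ->
  \int[P]_w (`|X t0 w| ^+ l)%:E <= (2^-1 * (l`!)%:R * M ^+ (l - 2) * v)%:E.

(** Markov's inequality for the exponential of lam times the sum, whose expectation factorises by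
    independence. The parameter lam stays free because its choice depends on whether v and M
    vanish. *)
Lemma chernoff_sum_le (x lam : R) : (0 <= lam)%R -> (lam * M < 1)%R ->
  P [set w | (n%:R * x <= \sum_t X t w)%R] <=
  (expR (n%:R * (lam ^+ 2 * v / (2 * (1 - lam * M)) - lam * x)))%:E.
Proof.
move=> lam0 lamM; set b := (lam ^+ 2 * v / _)%R.
set A := [set w | _].
have mS : measurable_fun setT (fun w => \sum_t X t w)%R.
  exact: measurable_sum.
have mA : measurable A by exact: measurable_ler_set.
have mY t : measurable_fun setT (fun w => expR (lam * X t w)).
  by apply: measurableT_comp => //; exact: measurable_funM.
have mf : measurable_fun setT (fun r : R => expR (lam * r)).
  by apply: measurableT_comp => //; exact: measurable_funM.
have EY t : \int[P]_w (expR (lam * X t w))%:E <= (expR b)%:E.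
  rewrite (@integral_comp_eq (X t) (X t0) (fun r => expR (lam * r)%R))//.
  - exact: integral_expR_le.
  - by move=> B mB; exact: idX.
have EprodY : \int[P]_w (\prod_t expR (lam * X t w))%:E <= (expR b ^+ n)%:E.
  rewrite expectation_prod_indep//.
  - apply: prode_le_expe => // t.
    by apply: integral_ge0 => w _; rewrite lee_fin expR_ge0.
  - move=> s; pose B t := [set r : R | (s t < expR (lam * r))%R].
    by apply: (indepX (B := B)) => t; exact: measurable_ltr_set.
(* The indicator of A is at most exp(lam (sum - n x)), which is at least 1 on A. *)
rewrite -[P A]mul1e -(@integral_cst _ _ _ P A mA 1) integral_mkcond.
apply: (@le_trans _ _ (\int[P]_w ((expR (- (lam * (n%:R * x))))%:E *
    (\prod_t expR (lam * X t w))%:E))).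
  apply: ge0_le_integral => //.
  - by move=> w _; rewrite patchE; case: ifP.
  - exact/(measurable_restrictT _ mA).
  - apply/measurable_EFinP/measurable_funM => //.
    by apply: measurable_prod => t _.
  - move=> w _; rewrite patchE; case: ifPn => [|_]; last first.
      by rewrite -EFinM lee_fin mulr_ge0 ?expR_ge0// prodr_ge0// => t _; exact: expR_ge0.
    rewrite inE /A/= => xS; rewrite -EFinM lee_fin -expR_sum -expRD.
    rewrite -mulr_sumr -[leLHS]expR0 ler_expR addrC subr_ge0.
    by rewrite ler_wpM2l.
rewrite ge0_integralZl_EFin//; last 2 first.
- by move=> w _; rewrite lee_fin prodr_ge0// => t _; exact: expR_ge0.
- by apply/measurable_EFinP; apply: measurable_prod => t _.
apply: le_trans (lee_wpmul2l _ EprodY) _; first by rewrite lee_fin expR_ge0.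
rewrite -EFinM lee_fin -expRM_natl -expRD le_eqVlt; apply/orP; left.
by apply/eqP; congr expR; ring.
Qed.

(** For v > 0 take lam = x / (v + M x). For v = 0 < M this would be the excluded value 1 / M, but
    half of it already gives the claimed exponent - n x / (2 M). For v = M = 0 every lam is allowed
    and the probability vanishes. *)
Lemma bernstein_sum_le (x : R) : (0 < x)%R ->
  P [set w | (n%:R * x <= \sum_t X t w)%R] <=
  (if (v == 0%R) && (M == 0%R) then 0%R
   else expR (- (n%:R * x ^+ 2 / (2 * (v + M * x)))))%:E.
Proof.
move=> x0; have n0 : (0 < n%:R :> R)%R by rewrite ltr0n (leq_ltn_trans _ (ltn_ord t0)).
have [v_eq0|v_neq0] := eqVneq v 0%R; last first.
  have vgt0 : (0 < v)%R by rewrite lt_neqAle eq_sym v_neq0.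
  have vMx : (0 < v + M * x)%R by rewrite ltr_pwDl// mulr_ge0// ltW.
  have lamM : (x / (v + M * x) * M < 1)%R.
    by rewrite mulrAC ltr_pdivrMr// mul1r mulrC ltrDr.
  apply: le_trans (chernoff_sum_le x _ lamM) _.
    by rewrite divr_ge0// ltW.
  rewrite lee_fin ler_expR le_eqVlt; apply/orP; left; apply/eqP.
  have -> : (1 - x / (v + M * x) * M = v / (v + M * x))%R.
    by field; rewrite gt_eqF.
  by field; rewrite v_neq0 gt_eqF.
have [M_eq0|M_neq0] /= := eqVneq M 0%R; last first.
  have Mgt0 : (0 < M)%R by rewrite lt_neqAle eq_sym M_neq0.
  have lamM : ((2 * M)^-1 * M < 1)%R.
    by rewrite invfM mulfVK// invf_lt1// ltr1n.
  apply: le_trans (chernoff_sum_le x _ lamM) _.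
    by rewrite invr_ge0 mulr_ge0.
  rewrite lee_fin ler_expR le_eqVlt; apply/orP; left; apply/eqP.
  rewrite v_eq0 mulr0 mul0r sub0r add0r.
  by field; rewrite M_neq0 gt_eqF.
set A := [set w | _]; rewrite leNgt; apply/negP => PA0.
have PAE : P A = (fine (P A))%:E.
  have lamM : (0 * M < 1)%R by rewrite mul0r.
  rewrite fineK// ge0_fin_numE//.
  exact: le_lt_trans (chernoff_sum_le x (lexx _) lamM) (ltry _).
set r := fine (P A) in PAE; have r0 : (0 < r)%R by rewrite -lte_fin -PAE.
(* With r = P A, this parameter turns the bound into r <= exp(- 1 / r), which contradicts exp(1 / r)
   > 1 / r. *)
have lam0 : (0 <= (r * n%:R * x)^-1)%R by rewrite invr_ge0 !mulr_ge0// ltW.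
have := chernoff_sum_le x lam0; rewrite M_eq0 mulr0 => /(_ ltr01).
rewrite -/A PAE v_eq0 lee_fin mulr0 mul0r sub0r.
rewrite (_ : n%:R * - _ = - r^-1)%R; last by field; rewrite !gt_eqF.
rewrite expRN leNgt => /negP; apply.
rewrite invf_plt ?posrE ?expR_gt0//.
by rewrite (lt_le_trans _ (expR_ge1Dx _))// ltrDr.
Qed.

End bernstein_iid.

(** * Measurability of the extreme eigenvalues *)

Section complex_measurability.
Context {d : measure_display} {T : measurableType d} {R : realType}.
Local Notation C := R[i].
Implicit Types X Y : T -> C.

Lemma crv_cst (z : C) : complex_random_variable (fun _ : T => z).
Proof. by split; exact: measurable_cst. Qed.

Lemma crvD X Y : complex_random_variable X -> complex_random_variable Y ->
  complex_random_variable (fun w => X w + Y w).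
Proof.
move=> [X1 X2] [Y1 Y2]; split.
- rewrite (_ : (fun w => _) = fun w => complex.Re (X w) + complex.Re (Y w)).
    exact: measurable_funD.
  by apply/funext => w; case: (X w) (Y w) => [? ?] [? ?].
- rewrite (_ : (fun w => _) = fun w => complex.Im (X w) + complex.Im (Y w)).
    exact: measurable_funD.
  by apply/funext => w; case: (X w) (Y w) => [? ?] [? ?].
Qed.

Lemma crvM X Y : complex_random_variable X -> complex_random_variable Y ->
  complex_random_variable (fun w => X w * Y w).
Proof.
move=> [X1 X2] [Y1 Y2]; split.
- rewrite (_ : (fun w => _) = fun w => complex.Re (X w) * complex.Re (Y w) -
      complex.Im (X w) * complex.Im (Y w)).
    by apply: measurable_funB; exact: measurable_funM.
  by apply/funext => w; case: (X w) (Y w) => [? ?] [? ?].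
- rewrite (_ : (fun w => _) = fun w => complex.Re (X w) * complex.Im (Y w) +
      complex.Im (X w) * complex.Re (Y w)).
    by apply: measurable_funD; exact: measurable_funM.
  by apply/funext => w; case: (X w) (Y w) => [? ?] [? ?].
Qed.

Lemma crvN X : complex_random_variable X ->
  complex_random_variable (fun w => - X w).
Proof.
move=> mX; rewrite (_ : (fun w => _) = fun w => (-1) * X w).
  by apply: crvM => //; exact: crv_cst.
by apply/funext => w; rewrite mulN1r.
Qed.

Lemma crv_conj X : complex_random_variable X ->
  complex_random_variable (fun w => (X w)^*).
Proof.
move=> [X1 X2]; split.
- by rewrite (_ : (fun w => _) = fun w => complex.Re (X w))//;
    apply/funext => w; case: (X w).
- rewrite (_ : (fun w => _) = fun w => - complex.Im (X w)).
    exact: measurable_funN.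
  by apply/funext => w; case: (X w).
Qed.

Lemma crv_sum (I : Type) (s : seq I) (F : I -> T -> C) :
  (forall i, complex_random_variable (F i)) ->
  complex_random_variable (fun w => \sum_(i <- s) F i w).
Proof.
move=> mF; elim: s => [|i s IH].
  under eq_fun do rewrite big_nil; exact: crv_cst.
under eq_fun do rewrite big_cons; exact: crvD.
Qed.

Lemma crv_mulmx (m n p : nat) (A : T -> 'M[C]_(m, n)) (B : T -> 'M[C]_(n, p)) :
  (forall i j, complex_random_variable (fun w => A w i j)) ->
  (forall i j, complex_random_variable (fun w => B w i j)) ->
  forall i j, complex_random_variable (fun w => (A w *m B w) i j).
Proof.
move=> mA mB i j; under eq_fun do rewrite mxE.
by apply: crv_sum => k; exact: crvM.
Qed.

Lemma crv_adjmx (m n : nat) (A : T -> 'M[C]_(m, n)) :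
  (forall i j, complex_random_variable (fun w => A w i j)) ->
  forall i j, complex_random_variable (fun w => ((A w)^t*) i j).
Proof.
by move=> mA i j; under eq_fun do rewrite !mxE; exact: crv_conj.
Qed.

Lemma crv_coef_prod (I : Type) (s : seq I) (F : I -> T -> {poly C}) :
  (forall i k, complex_random_variable (fun w => (F i w)`_k)) ->
  forall k, complex_random_variable (fun w => (\prod_(i <- s) F i w)`_k).
Proof.
move=> mF; elim: s => [|i s IH] k.
  under eq_fun do rewrite big_nil; exact: crv_cst.
under eq_fun do rewrite big_cons coefM.
by apply: crv_sum => l; exact: crvM.
Qed.

Lemma crv_coef_char_poly (D : nat) (A : T -> 'M[C]_D) :
  (forall i j, complex_random_variable (fun w => A w i j)) ->
  forall k, complex_random_variable (fun w => (char_poly (A w))`_k).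
Proof.
move=> mA k; rewrite /char_poly /determinant.
under eq_fun do rewrite coef_sum; apply: crv_sum => s.
under eq_fun do rewrite -signr_odd mulr_sign.
have mprod (f : 'I_D -> 'I_D) l : complex_random_variable
    (fun w => (\prod_i (char_poly_mx (A w)) i (f i))`_l).
  apply: crv_coef_prod => i {}l; under eq_fun do rewrite !mxE coefB coefMn coefC.
  apply: crvD; first exact: crv_cst.
  apply: crvN; case: (l == 0)%N; last exact: crv_cst.
  exact: mA.
case: (odd _); last exact: mprod.
under eq_fun do rewrite coefN; apply: crvN; exact: mprod.
Qed.

(** Rays above c generate the Borel sets, and the complement of the preimage of such a ray is given
    by countably many inequalities between measurable functions. *)
Lemma measurable_lambda_max (D : nat) (A : T -> 'M[C]_D) : (0 < D)%N ->
  (forall i j, complex_random_variable (fun w => A w i j)) ->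
  (forall w, (A w)^t* = A w) ->
  measurable_fun setT (fun w => lambda_max (A w)).
Proof.
move=> D0 mA hA mD; apply: (measurability _ (RGenOInfty.measurableE R)) => //.
move=> _ [_ [c ->] <-]; rewrite setTI.
rewrite (_ : _ @^-1` _ = ~` \bigcap_k [set w |
    0 <= complex.Re (char_poly (A w - c%:C%:M))`_k]); last first.
  apply/seteqP; split => w /=; rewrite in_itv/= andbT ltNge.
    move=> /negP lc cap; apply: lc.
    by apply/(lambda_max_le_coef_char_poly c D0 (hA w)) => k; exact: cap.
  move=> cap; apply/negP => /(lambda_max_le_coef_char_poly c D0 (hA w)) lc.
  by apply: cap => k _ /=; exact: lc.
apply: measurableC; apply: bigcapT_measurable => k.
have mB i j : complex_random_variable (fun w => (A w - c%:C%:M) i j).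
  under eq_fun do rewrite !mxE; apply: crvD => //; exact: crv_cst.
have [mRe _] := crv_coef_char_poly mB k.
exact: measurable_ler_set.
Qed.

Lemma measurable_lambda_min (D : nat) (A : T -> 'M[C]_D) : (0 < D)%N ->
  (forall i j, complex_random_variable (fun w => A w i j)) ->
  (forall w, (A w)^t* = A w) ->
  measurable_fun setT (fun w => lambda_min (A w)).
Proof.
move=> D0 mA hA; under eq_fun do rewrite lambda_minE.
apply: measurable_funN; apply: measurable_lambda_max => // [i j|w].
  by under eq_fun do rewrite mxE; exact: crvN.
by rewrite adjmxN hA.
Qed.

Lemma measurable_opnorm_lt (D : nat) (A : T -> 'M[C]_D) (eps : R) :
  (0 < D)%N -> 0 < eps ->
  (forall i j, complex_random_variable (fun w => A w i j)) ->
  measurable [set w | opnorm (A w) < eps].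
Proof.
move=> D0 eps0 mA.
rewrite (_ : [set w | _] = [set w | lambda_max ((A w)^t* *m A w) < eps ^+ 2]).
  apply: measurable_ltr_set => //; apply: measurable_lambda_max => //.
    by apply: crv_mulmx => //; exact: crv_adjmx.
  by move=> w; exact: gram_hermitian.
have epsE : eps = Num.sqrt (eps ^+ 2) by rewrite sqrtr_sqr gtr0_norm.
apply/funext => w; apply/propext.
by rewrite /= /opnorm {1}epsE ltr_sqrt ?exprn_gt0.
Qed.

End complex_measurability.

(** * Union bound for finitely many events *)

Section union_bound.
Context {d : measure_display} {T : measurableType d} {R : realType}.
Variable P : probability T R.

Lemma probability_ge_union_bound (I : finType) (B : I -> set T) (A : set T)
    (e : R) :
  (forall i, measurable (B i)) -> measurable A ->
  (forall i, (P (B i) <= e%:E)%E) ->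
  (forall w, (forall i, ~ B i w) -> A w) ->
  ((1 - #|I|%:R * e)%:E <= P A)%E.
Proof.
move=> mB mA PB BA; pose V := \big[setU/set0]_i B i.
have [mV PV] : measurable V /\ (P V <= \sum_i P (B i))%E.
  rewrite /V; elim/big_rec2: _ => [|i y W _ [mW PW]].
    by rewrite measure0.
  split; first exact: measurableU.
  exact: le_trans (measureU2 _ (mB i) mW) (leeD2l _ PW).
have Ve : (P V <= (#|I|%:R * e)%:E)%E.
  apply: (le_trans PV); apply: (@le_trans _ _ (\sum_(i : I) e%:E)%E).
    exact: lee_sum.
  by rewrite sumEFin lee_fin sumr_const mulr_natl.
apply: (@le_trans _ _ (P (~` V))); last first.
  apply: le_measure; rewrite ?inE//; first exact: measurableC.
  move=> w Vw; apply: BA => i Bi; apply: Vw.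
  by rewrite /V (bigD1 i)//=; left.
by rewrite probability_setC// EFinB leeB.
Qed.

End union_bound.

(** * Deviations of functions of the rows *)

(* Required by g_sigma_algebraType for rows over R[i]. *)
HB.instance Definition _ (R : realType) := isPointed.Build R[i] 0.

Section row_functions.
Context {R : realType}.
Local Notation C := R[i].

(* The family generating borel_row, named to speak of the measurable type of
   rows. *)
Definition borel_row_gen (D : nat) : set (set 'rV[C]_D) :=
  [set B : set 'rV[C]_D | exists (k : 'I_D) (A : set R), measurable A /\
     (B = [set x : 'rV[C]_D | A (complex.Re (x 0 k))] \/
      B = [set x : 'rV[C]_D | A (complex.Im (x 0 k))])].

Local Notation rowT D := (g_sigma_algebraType (borel_row_gen (D := D))).

Lemma crv_coord (D : nat) (k : 'I_D) :
  complex_random_variable (fun x : rowT D => (x : 'rV[C]_D) 0 k).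
Proof.
split=> _ A mA; rewrite setTI; apply: sub_sigma_algebra; exists k, A; split=> //.
- by left.
- by right.
Qed.

(** The summand that one row contributes to an entry of the Gram matrix, as a function of the row so
    that independence of the rows applies to it. *)
Definition row_gram (D : nat) (k j : 'I_D) (x : 'rV[C]_D) : C :=
  (x 0 k)^* * x 0 j.

(** A boolean selects the part, so that real and imaginary parts share their proofs and the union
    bound can range over them. *)
Definition part (b : bool) (z : C) : R := if b then complex.Im z else complex.Re z.

(** [borel_row] is the sigma-algebra of [rowT D], so the claim is measurability on that space of a
    polynomial in the real and imaginary parts of the coordinates. *)
Lemma borel_row_gram (D : nat) (k j : 'I_D) (b : bool) (A : set R) :
  measurable A -> borel_row [set x : 'rV[C]_D | A (part b (row_gram k j x))].
Proof.
have [mRe mIm] : complex_random_variable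
    (fun x : rowT D => row_gram k j (x : 'rV[C]_D)).
  by apply: crvM; [apply: crv_conj|]; exact: crv_coord.
move=> mA; have : measurable_fun setT
    (fun x : rowT D => part b (row_gram k j (x : 'rV[C]_D))).
  by case: b; [exact: mIm|exact: mRe].
by move=> /(_ measurableT A mA); rewrite setTI.
Qed.

End row_functions.

Section centered.
Context {d : measure_display} {T : measurableType d} {R : realType}.
Variable P : probability T R.
Local Open Scope ereal_scope.

(** On a probability space, |X| <= 1 + |X| ^ 2 suffices. *)
Lemma integrable_sqr (X : T -> R) : measurable_fun setT X ->
  \int[P]_w (`|X w| ^+ 2)%:E < +oo -> P.-integrable setT (EFin \o X).
Proof.
move=> mX X2; apply/integrableP; split; first exact/measurable_EFinP.
have mX2 : measurable_fun setT (fun w => `|X w| ^+ 2)%R.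
  by apply: measurable_funX; exact: measurableT_comp.
apply: (@le_lt_trans _ _ (\int[P]_w (1 + (`|X w| ^+ 2)%:E))).
  apply: ge0_le_integral => //.
  - by apply/measurable_EFinP; exact: measurableT_comp.
  - by apply: emeasurable_funD => //; exact/measurable_EFinP.
  - move=> w _ /=; rewrite -EFinD lee_fin.
    by have := sqr_ge0 (`|X w| - 1)%R; have := normr_ge0 (X w); nra.
rewrite ge0_integralD//; last exact/measurable_EFinP.
by rewrite lte_add_pinfty// (integral_cst_probability P 1) ltry.
Qed.

(** Integrability of Y is not given, and [fine] would return 0 for an infinite integral. The second
    moment of Y - q, whatever the real number q, makes Y - q and hence Y integrable; only this shows
    that q is the mean. *)
Lemma centered_mean0 (Y : T -> R) (q := fine (\int[P]_w (Y w)%:E)) :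
  measurable_fun setT Y -> \int[P]_w (`|Y w - q| ^+ 2)%:E < +oo ->
  [/\ P.-integrable setT (EFin \o Y),
      P.-integrable setT (fun w => (Y w - q)%:E) &
      \int[P]_w (Y w - q)%:E = 0].
Proof.
move=> mY Y2.
have mX : measurable_fun setT (fun w => Y w - q)%R by exact: measurable_funB.
have iX := integrable_sqr mX Y2.
have iq : P.-integrable setT (EFin \o cst q).
  exact: finite_measure_integrable_cst.
have iY : P.-integrable setT (EFin \o Y).
  apply: eq_integrable (integrableD measurableT iX iq) => // w _ /=.
  by rewrite -EFinD subrK.
split=> //; transitivity (\int[P]_w ((EFin \o Y) w - (EFin \o cst q) w)).
  by apply: eq_integral => w _ /=; rewrite EFinB.
rewrite integralB//.
have -> : \int[P]_w (EFin \o cst q) w = q%:E.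
  transitivity (\int[P]_w cst q%:E w); first exact: eq_integral.
  exact: integral_cst_probability.
have -> : \int[P]_w (EFin \o Y) w = q%:E.
  by rewrite /q fineK//; exact: integrable_fin_num.
by rewrite -EFinB subrr.
Qed.

End centered.

Section row_deviation.
Context {d : measure_display} {T : measurableType d} {R : realType}.
Variables (P : probability T R) (n D : nat) (U : T -> 'M[R[i]]_(n, D)).
Hypothesis U_indep : independent_rows P U.
Hypothesis U_id : identically_distributed_rows P U.
Local Open Scope ereal_scope.

(** The variables (-1) ^ s (h - q) of the rows satisfy the hypotheses of [bernstein_sum_le]; the
    sign s gives access to both tails. *)
Lemma row_deviation (t0 : 'I_n) (h : 'rV[R[i]]_D -> R) (q M v x : R) (s : bool) :
  (forall A : set R, measurable A -> borel_row [set y | A (h y)]) ->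
  (forall t, measurable_fun setT (fun w => h (row t (U w)))) ->
  q = fine 'E_P[fun w => h (row t0 (U w))] ->
  (0 <= M)%R -> (0 <= v)%R -> (0 < x)%R ->
  (forall l, (2 <= l)%N -> 'E_P[fun w => (`|h (row t0 (U w)) - q| ^+ l)%R] <=
     (2^-1 * (l`!)%:R * M ^+ (l - 2) * v)%:E) ->
  P [set w | (n%:R * x <= \sum_t (-1) ^+ s * (h (row t (U w)) - q))%R] <=
  (if (v == 0%R) && (M == 0%R) then 0%R
   else expR (- (n%:R * x ^+ 2 / (2 * (v + M * x)))))%:E.
Proof.
move=> bh mh qE M0 v0 x0 mom.
rewrite unlock in qE.
have {}mom l : (2 <= l)%N -> \int[P]_w (`|h (row t0 (U w)) - q| ^+ l)%:E <=
    (2^-1 * (l`!)%:R * M ^+ (l - 2) * v)%:E.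
  by move=> /mom; rewrite unlock.
have [iX EX] : P.-integrable setT (fun w => (h (row t0 (U w)) - q)%:E) /\
    \int[P]_w (h (row t0 (U w)) - q)%:E = 0.
  have := @centered_mean0 _ _ _ P _ (mh t0); rewrite -qE => -[]//.
  exact: le_lt_trans (mom 2%N isT) (ltry _).
pose f (r : R) : R := ((-1) ^+ s * (r - q))%R.
have mf : measurable_fun setT f.
  by apply: measurable_funM => //; exact: measurable_funB.
have bf (A : set R) : measurable A -> borel_row [set y | A (f (h y))].
  move=> mA; apply: (bh (f @^-1` A)); rewrite -[X in measurable X]setTI.
  exact: mf.
apply: (@bernstein_sum_le _ _ _ P n (fun t w => f (h (row t (U w)))) t0) => //.
- move=> t; exact: measurableT_comp.
- move=> B mB.
  have := @U_indep [set: 'I_n]%SET (fun t => [set y | B t (f (h y))])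
    (fun t _ => bf _ (mB t)).
  rewrite (eq_bigl xpredT) => [<-|t]; last by rewrite finset.in_setT.
  congr (P _); apply/seteqP; split => w /= Bw t; first by move=> _; exact: Bw.
  by apply: Bw; rewrite finset.in_setT.
- by move=> t B mB; exact: (@U_id t t0 [set y | B (f (h y))] (bf _ mB)).
- rewrite (_ : _ \o _ = fun w => ((-1) ^+ s)%:E * (h (row t0 (U w)) - q)%:E).
    exact: integrableZl.
  by apply/funext => w /=; rewrite -EFinM.
- rewrite (eq_integral (fun w => ((-1) ^+ s)%:E * (h (row t0 (U w)) - q)%:E)).
    by rewrite integralZl// EX mule0.
  by move=> w _; rewrite -EFinM.
- move=> l l2; rewrite (eq_integral (fun w => (`|h (row t0 (U w)) - q| ^+ l)%:E)).
    exact: mom.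
  by move=> w _; rewrite /f normrMsign.
Qed.

End row_deviation.

(** * Concentration of the Gram matrix *)

Section spectral_perturbation.
Context {R : realType}.
Local Notation C := R[i].

(** Weyl's inequality for A = Q + (A - Q), where the extreme eigenvalues of A - Q lie strictly
    between - eps and eps; the lower bound applies it to - Q and - (A - Q). *)
Lemma lambda_perturbation (D : nat) (Q A : 'M[C]_D) (eps : R) : (0 < D)%N ->
  Q^t* = Q -> A^t* = A -> opnorm (A - Q) < eps ->
  lambda_min Q - eps < lambda_min A /\ lambda_max A < lambda_max Q + eps.
Proof.
move=> D0 QQ AA AQeps; have EE : (A - Q)^t* = A - Q by rewrite adjmxB AA QQ.
have max_lt : lambda_max (A - Q) < eps.
  apply: le_lt_trans (ler_norm _) (le_lt_trans _ AQeps).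
  by apply: eigenvalue_le_opnorm => //; exact: eigenvalue_lambda_max.
have min_gt : - eps < lambda_min (A - Q).
  rewrite ltrNl; apply: le_lt_trans (ler_norm _) _; rewrite normrN.
  apply: le_lt_trans AQeps.
  by apply: eigenvalue_le_opnorm => //; exact: eigenvalue_lambda_min.
split.
  have := @lambda_maxD _ _ (- Q) (- (A - Q)) D0.
  rewrite !adjmxN QQ EE => /(_ erefl erefl).
  rewrite -opprD addrC subrK.
  move: min_gt; rewrite !lambda_minE.
  move: (lambda_max (- (A - Q))) (lambda_max (- Q)) (lambda_max (- A)) => a b c.
  by clear; lra.
have := @lambda_maxD _ _ Q (A - Q) D0 QQ EE; rewrite addrC subrK.
by move/le_lt_trans; apply; rewrite ltrD2l.
Qed.

(** Comparison with the Frobenius norm; the strict inequality survives the sums since m and D are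
    positive. *)
Lemma opnorm_lt_entries (m D : nat) (A : 'M[C]_(m, D)) (x : R) :
  (0 < m)%N -> (0 < D)%N ->
  (forall i j (b : bool), `|part b (A i j)| < x) ->
  opnorm A < Num.sqrt (m%:R * D%:R * (2 * x ^+ 2)).
Proof.
move=> m0 D0 Ax; apply: le_lt_trans (opnorm_le_frobenius A D0) _.
have x0 : 0 < x := le_lt_trans (normr_ge0 _) (Ax (Ordinal m0) (Ordinal D0) true).
have mD0 : 0 < m%:R * D%:R * (2 * x ^+ 2) :> R.
  by rewrite !mulr_gt0 ?ltr0n// exprn_gt0.
rewrite ltr_sqrt//.
have -> : m%:R * D%:R * (2 * x ^+ 2) = \sum_(i < m) \sum_(j < D) (2 * x ^+ 2).
  by rewrite !sumr_const !card_ord -mulrnA -[RHS]mulr_natl natrM [D%:R * _]mulrC.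
have sq b i j : part b (A i j) ^+ 2 < x ^+ 2.
  by rewrite -real_normK ?num_real// ltr_pXn2r ?nnegrE// ltW.
apply: ltr_sum => [|i _].
  by apply/hasP; exists (Ordinal m0) => //; rewrite mem_index_enum.
apply: ltr_sum => [|j _].
  by apply/hasP; exists (Ordinal D0) => //; rewrite mem_index_enum.
by rewrite /sqmod mulr_natl mulr2n ltrD// ?(sq false)// (sq true).
Qed.

End spectral_perturbation.

Section gram_matrix.
Context {d : measure_display} {T : measurableType d} {R : realType}.
Local Notation C := R[i].

Lemma partB (b : bool) (x y : C) : part b (x - y) = part b x - part b y.
Proof. by case: b; [exact: ImB|exact: ReB]. Qed.

Lemma part_sum (b : bool) (I : Type) (s : seq I) (F : I -> C) :
  part b (\sum_(i <- s) F i) = \sum_(i <- s) part b (F i).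
Proof. by case: b; [exact: Im_sum|exact: Re_sum]. Qed.

Lemma partZ (b : bool) (a : R) (z : C) : part b (a%:C * z) = a * part b z.
Proof. by case: b; [exact: Im_scale|exact: Re_scale]. Qed.

Lemma part_gram_deviation (n D : nat) (A : 'M[C]_(n, D)) (Q : 'M[C]_D) k j b :
  (0 < n)%N ->
  part b ((n%:R^-1 *: (A^t* *m A) - Q) k j) =
  n%:R^-1 * \sum_t (part b (row_gram k j (row t A)) - part b (Q k j)).
Proof.
move=> n0; have nC : n%:R^-1 = (n%:R^-1)%:C :> C.
  by rewrite rmorphV ?unitfE ?pnatr_eq0 -?lt0n// rmorph_nat.
rewrite nC !mxE partB partZ part_sum sumrB mulrBr; congr (_ - _).
  by congr (_ * _); apply: eq_bigr => t _; rewrite /row_gram !mxE.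
rewrite sumr_const card_ord -[part b (Q k j) *+ n]mulr_natl mulrA.
rewrite mulVf ?mul1r// pnatr_eq0.
by rewrite -lt0n.
Qed.

Lemma row_gram_swap (D : nat) (k j : 'I_D) (b : bool) (y : 'rV[C]_D) :
  part b (row_gram k j y) = (-1) ^+ b * part b (row_gram j k y).
Proof.
rewrite /row_gram; case: b (y 0 k) (y 0 j) => -[a1 b1] [a2 b2] /=.
  by rewrite expr1; ring.
by rewrite expr0; ring.
Qed.

(** Exchanging k and j conjugates [row_gram], and integrability lets the sign of the imaginary part
    leave the expectation. *)
Lemma second_moment_hermitian (P : probability T R) (n D : nat)
    (U : T -> 'M[C]_(n, D)) (t : 'I_n) :
  (forall k j b, P.-integrable setT
     (EFin \o (fun w => part b (row_gram k j (row t (U w)))))) ->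
  (second_moment_mx P U t)^t* = second_moment_mx P U t.
Proof.
move=> iU; apply/matrixP => k j; rewrite !mxE /complex_expectation !unlock.
have rowE i l w : row_gram i l (row t (U w)) = (U w t i)^* * U w t l.
  by rewrite /row_gram !mxE.
have E b : fine (\int[P]_w (part b ((U w t j)^* * U w t k))%:E) =
    (-1) ^+ b * fine (\int[P]_w (part b ((U w t k)^* * U w t j))%:E).
  rewrite (eq_integral (fun w => ((-1) ^+ b)%:E *
      (part b (row_gram k j (row t (U w))))%:E)%E); last first.
    by move=> w _; rewrite -rowE row_gram_swap EFinM.
  have -> := integralZl measurableT (iU k j b) ((-1) ^+ b).
  rewrite fineM//; last exact: integrable_fin_num.
  by congr (_ * fine _); apply: eq_integral => w _; rewrite /= rowE.
move: (E false) (E true); rewrite /part expr0 expr1 mul1r mulN1r => -> ->.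
by apply/eqP; rewrite eq_complex /= opprK !eqxx.
Qed.

End gram_matrix.

Section gram_concentration.
Context {d : measure_display} {T : measurableType d} {R : realType}.
Local Notation C := R[i].
Variables (P : probability T R) (n D : nat) (U : T -> 'M[C]_(n, D)).
Hypotheses (n_gt0 : (0 < n)%N) (D_gt0 : (0 < D)%N).
Hypothesis U_rv : forall t k, complex_random_variable (fun w => U w t k).
Hypothesis U_indep : independent_rows P U.
Hypothesis U_id : identically_distributed_rows P U.
Let t0 := Ordinal n_gt0.
Let Q := second_moment_mx P U t0.
Let S w := n%:R^-1 *: ((U w)^t* *m U w).
Variables (M v eps : R).
Hypotheses (M_ge0 : 0 <= M) (v_ge0 : 0 <= v) (eps_gt0 : 0 < eps).
Hypothesis moments : forall (b : bool) (k j : 'I_D) (l : nat), (2 <= l)%N ->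
  ('E_P[fun w => (`|part b (row_gram k j (row t0 (U w))) -
                   part b (Q k j)| ^+ l)%R] <=
   (2^-1 * (l`!)%:R * M ^+ (l - 2) * v)%:E)%E.

Lemma part_second_moment b k j :
  part b (Q k j) = fine 'E_P[fun w => part b (row_gram k j (row t0 (U w)))].
Proof.
rewrite /Q mxE /complex_expectation; case: b => /=; congr (fine (expectation P _));
  by apply/funext => w; rewrite /row_gram !mxE.
Qed.

Lemma measurable_row_gram t k j b :
  measurable_fun setT (fun w => part b (row_gram k j (row t (U w)))).
Proof.
have [mRe mIm] : complex_random_variable (fun w => row_gram k j (row t (U w))).
  rewrite /row_gram; under eq_fun do rewrite !mxE.
  by apply: crvM => //; exact: crv_conj.
by case: b; [exact: mIm|exact: mRe].
Qed.

Lemma second_moment_adj : Q^t* = Q.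
Proof.
apply: second_moment_hermitian => k j b.
have := @centered_mean0 _ _ _ P _ (measurable_row_gram t0 k j b).
have := part_second_moment b k j; rewrite unlock => <- -[]//.
have := moments b k j (leqnn 2); rewrite unlock => /le_lt_trans; apply.
exact: ltry.
Qed.

Lemma crv_scaled_gram i j : complex_random_variable (fun w => S w i j).
Proof.
rewrite /S; under eq_fun do rewrite mxE; apply: crvM; first exact: crv_cst.
by apply: crv_mulmx => //; exact: crv_adjmx.
Qed.

(* With x = sqrt 2 * eps / (2 * D), if all real and imaginary parts of the
   entries of S - Q are smaller than x, then its squared Frobenius norm is
   smaller than 2 * D^2 * x^2 = eps^2. *)
Lemma probability_opnorm_deviation_ge :
  ((prob_bound n D M v eps)%:E <= P [set w | (opnorm (S w - Q) < eps)%R])%E.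
Proof.
pose x := Num.sqrt 2 * eps / (2 * D%:R).
have D0 : (0 < D%:R :> R) by rewrite ltr0n.
have n0 : (0 < n%:R :> R) by rewrite ltr0n.
have s2 : Num.sqrt 2 ^+ 2 = 2 :> R by rewrite sqr_sqrtr.
have s0 : 0 < Num.sqrt 2 :> R by rewrite sqrtr_gt0.
have x0 : 0 < x by rewrite divr_gt0// mulr_gt0.
have x2 : 2 * D%:R ^+ 2 * x ^+ 2 = eps ^+ 2.
  rewrite /x !exprMn exprVn exprMn s2.
  by field; rewrite gt_eqF.
(* An index is an entry, a part and a sign, which gives the factor 4 D ^ 2. *)
pose I := ('I_D * 'I_D * bool * bool)%type.
pose dev (i : I) w := \sum_t (-1) ^+ i.2 *
  (part i.1.2 (row_gram i.1.1.1 i.1.1.2 (row t (U w))) -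
   part i.1.2 (Q i.1.1.1 i.1.1.2)).
pose B (i : I) := [set w | n%:R * x <= dev i w].
have mB i : measurable (B i).
  apply: measurable_ler_set => //; apply: measurable_sum => t.
  apply: measurable_funM => //; apply: measurable_funB => //.
  exact: measurable_row_gram.
have mA : measurable [set w | opnorm (S w - Q) < eps].
  apply: measurable_opnorm_lt => // i j.
  rewrite (_ : (fun w => _) = fun w => S w i j + (- Q) i j).
    by apply: crvD; [exact: crv_scaled_gram|exact: crv_cst].
  by apply/funext => w; rewrite mxE.
have PB i : (P (B i) <= (exp_term n D M v eps)%:E)%E.
  case: i => [[[k j] b] s].
  apply: le_trans (@row_deviation _ _ _ P n D U U_indep U_id t0
    (fun y => part b (row_gram k j y)) (part b (Q k j)) M v x s _ _ _ M_ge0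
    v_ge0 x0 _) _.
  - by move=> A mA'; exact: borel_row_gram.
  - by move=> t; exact: measurable_row_gram.
  - exact: part_second_moment.
  - exact: moments.
  rewrite /exp_term lee_fin; case: ifP => // vM.
  rewrite ler_expR lerN2 le_eqVlt; apply/orP; left; apply/eqP.
  have vM0 : 0 < v + M * x.
    move/negbT: vM; rewrite negb_and => /orP[v_neq0|M_neq0].
      by rewrite ltr_pwDl ?lt_neqAle 1?eq_sym ?v_neq0// mulr_ge0// ltW.
    by rewrite ltr_wpDl// mulr_gt0// lt_neqAle eq_sym M_neq0.
  (* By the choice of x, 4 x = 2 sqrt 2 D^-1 eps; with eps ^ 2 = 2 D ^ 2 x ^ 2 the exponents
     agree. *)
  have -> : 4 * v + 2 * Num.sqrt 2 * D%:R^-1 * M * eps = 4 * (v + M * x).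
    by rewrite /x; field; rewrite gt_eqF.
  by rewrite -x2; field; rewrite !gt_eqF.
rewrite /prob_bound (_ : 4 * D%:R ^+ 2 = #|{: I}|%:R); last first.
  by rewrite !card_prod card_bool card_ord !natrM; ring.
apply: (probability_ge_union_bound mB mA PB) => w nB /=.
have -> : eps = Num.sqrt (D%:R * D%:R * (2 * x ^+ 2)).
  by rewrite mulrA [_ * 2]mulrC -expr2 x2 sqrtr_sqr gtr0_norm.
apply: opnorm_lt_entries => // k j b.
rewrite part_gram_deviation// normrM ger0_norm ?invr_ge0 ?ler0n//.
rewrite mulrC ltr_pdivrMr// [x * _]mulrC ltr_norml.
(* The two signs bound the sum from above and from below. *)
have := nB (k, j, b, false); have := nB (k, j, b, true).
rewrite /B /dev /= -!mulr_sumr expr0 expr1 mul1r mulN1r.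
by move=> /negP; rewrite -ltNge ltrNl => -> /negP; rewrite -ltNge => ->.
Qed.

End gram_concentration.

Theorem theorem3p1 (R : realType) (d : measure_display) (T : measurableType d)
  (P : probability T R) (n D : nat) (n_gt0 : (0 < n)%N) (D_gt0 : (0 < D)%N)
  (U : T -> 'M[R[i]]_(n, D))
  (U_rv : forall t k, complex_random_variable (fun w => U w t k))
  (U_indep : independent_rows P U)
  (U_id : identically_distributed_rows P U)
  (U_L2 : forall k : 'I_D,
     ('E_P[fun w => (Normc.normc (U w (Ordinal n_gt0) k) ^+ 2)%R] < +oo)%E)
  (Q : 'M[R[i]]_D) (Q_def : Q = second_moment_mx P U (Ordinal n_gt0))
  (M : R) (v : 'M[R]_D) (M_ge0 : 0 <= M) (v_ge0 : forall k j, 0 <= v k j)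
  (moment_Re : forall (l : nat) (k j : 'I_D), (2 <= l)%N ->
     ('E_P[fun w => (`|complex.Re ((U w (Ordinal n_gt0) k)^* *
                                 U w (Ordinal n_gt0) j - Q k j)| ^+ l)%R]
      <= (2^-1 * (l`!)%:R * M ^+ (l - 2) * v k j)%:E)%E)
  (moment_Im : forall (l : nat) (k j : 'I_D), (2 <= l)%N ->
     ('E_P[fun w => (`|complex.Im ((U w (Ordinal n_gt0) k)^* *
                                 U w (Ordinal n_gt0) j - Q k j)| ^+ l)%R]
      <= (2^-1 * (l`!)%:R * M ^+ (l - 2) * v k j)%:E)%E)
  (eps : R) (eps_gt0 : 0 < eps) :
  let p := prob_bound n D M (max_entry v) eps in
  let S := fun w => n%:R^-1 *: ((U w) ^t* *m U w) in
  [/\ (p%:E <= P [set w | (opnorm (S w - Q) < eps)%R])%E,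
      (p%:E <= P [set w | [/\ (lambda_min Q - eps < lambda_min (S w))%R,
                              (lambda_min (S w) <= lambda_max (S w))%R
                            & (lambda_max (S w) < lambda_max Q + eps)%R]])%E
    & Q \in unitmx -> eps < lambda_min Q ->
      (p%:E <= P [set w | (U w) ^t* *m U w \in unitmx /\
                          (condition_number ((U w) ^t* *m U w) <=
                           (lambda_max Q + eps) / (lambda_min Q - eps))%R])%E].
Proof.
move=> p S; subst Q.
set Q := second_moment_mx P U _ in moment_Re moment_Im p S *.
have v_le k j : v k j <= max_entry v.
  exact: (le_bigmax 0 (fun kj : 'I_D * 'I_D => v kj.1 kj.2) (k, j)).
have vmax_ge0 : 0 <= max_entry v by exact: bigmax_ge_id.
(* The moment bounds increase with v, so all entries can share the largest one. *)
have moments (b : bool) (k j : 'I_D) (l : nat) : (2 <= l)%N ->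
    ('E_P[fun w => (`|part b (row_gram k j (row (Ordinal n_gt0) (U w))) -
                     part b (Q k j)| ^+ l)%R] <=
     (2^-1 * (l`!)%:R * M ^+ (l - 2) * max_entry v)%:E)%E.
  move=> l2; apply: (@le_trans _ _ (2^-1 * (l`!)%:R * M ^+ (l - 2) * v k j)%:E).
    have /= := if b return (('E_P[fun w => (`|part b ((U w (Ordinal n_gt0) k)^* *
        U w (Ordinal n_gt0) j - Q k j)| ^+ l)%R]
        <= (2^-1 * (l`!)%:R * M ^+ (l - 2) * v k j)%:E)%E) then moment_Im l k j l2
        else moment_Re l k j l2.
    congr (('E_P[_] <= _)%E); apply/funext => w.
    by rewrite -partB /row_gram !mxE.
  by rewrite lee_fin ler_wpM2l// !mulr_ge0 ?exprn_ge0// invr_ge0.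
have QQ : Q^t* = Q by exact: second_moment_adj moments.
have SE w : S w = (n%:R^-1)%:C *: ((U w)^t* *m U w).
  by rewrite /S rmorphV ?unitfE ?pnatr_eq0 -?lt0n// rmorph_nat.
have SS w : (S w)^t* = S w by rewrite SE adjmxZ gram_hermitian.
have P1 := probability_opnorm_deviation_ge D_gt0 U_rv U_indep U_id M_ge0
  vmax_ge0 eps_gt0 moments.
have nV0 : 0 < n%:R^-1 :> R by rewrite invr_gt0 ltr0n.
have mS := crv_scaled_gram U_rv.
have mG i j : complex_random_variable (fun w => ((U w)^t* *m U w) i j).
  by apply: crv_mulmx => //; exact: crv_adjmx.
have mA1 : measurable [set w | opnorm (S w - Q) < eps].
  apply: measurable_opnorm_lt => // i j.
  rewrite (_ : (fun w => _) = fun w => S w i j + (- Q) i j).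
    by apply: crvD; [exact: mS|exact: crv_cst].
  by apply/funext => w; rewrite mxE.
pose A2 := [set w | [/\ lambda_min Q - eps < lambda_min (S w),
  lambda_min (S w) <= lambda_max (S w) & lambda_max (S w) < lambda_max Q + eps]].
have mA2 : measurable A2.
  rewrite (_ : A2 = [set w | lambda_min Q - eps < lambda_min (S w)] `&`
      [set w | lambda_min (S w) <= lambda_max (S w)] `&`
      [set w | lambda_max (S w) < lambda_max Q + eps]); last first.
    by apply/seteqP; split => w /= [] //; case.
  have mmin := measurable_lambda_min D_gt0 mS SS.
  have mmax := measurable_lambda_max D_gt0 mS SS.
  apply: measurableI; [apply: measurableI|].
  - exact: measurable_ltr_set.
  - exact: measurable_ler_set.
  - exact: measurable_ltr_set.
have P2 : (p%:E <= P A2)%E.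
  apply: (le_trans P1); apply: le_measure; rewrite ?inE// => w /= SQ.
  have [minS maxS] := lambda_perturbation D_gt0 QQ (SS w) SQ.
  by split=> //; exact: lambda_min_le_max.
split=> // _ eps_lt; apply: (le_trans P2).
set C0 := (_ + _) / (_ - _).
have minQ_gt0 : 0 < lambda_min Q - eps by rewrite subr_gt0.
(* A Gram matrix has no negative eigenvalue, so it is nonsingular exactly when [lambda_min] is
   positive; the bound on the quotient can then be multiplied out. Both resulting events are
   measurable. *)
rewrite (_ : [set w | _] = [set w | 0 < lambda_min ((U w)^t* *m U w)] `&`
    [set w | lambda_max ((U w)^t* *m U w) <= C0 * lambda_min ((U w)^t* *m U w)]).
  apply: le_measure; first exact: mem_set.
    apply: mem_set.
    have mmin := measurable_lambda_min D_gt0 mG (fun w => gram_hermitian (U w)).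
    have mmax := measurable_lambda_max D_gt0 mG (fun w => gram_hermitian (U w)).
    apply: measurableI; first exact: measurable_ltr_set.
    by apply: measurable_ler_set => //; exact: measurable_funM.
  move=> w [minS min_max maxS].
  have minS0 := lt_trans minQ_gt0 minS.
  have minE : lambda_min (S w) = n%:R^-1 * lambda_min ((U w)^t* *m U w).
    by rewrite SE (lambda_minZ D_gt0 (gram_hermitian (U w)) nV0).
  have maxE : lambda_max (S w) = n%:R^-1 * lambda_max ((U w)^t* *m U w).
    by rewrite SE (lambda_maxZ D_gt0 (gram_hermitian (U w)) nV0).
  move: min_max maxS minS minS0; rewrite /= minE maxE.
  move: (lambda_min (_ *m _)) (lambda_max (_ *m _)) => a b.
  move=> min_max maxS minS minS0; split; first by move: minS0; rewrite pmulr_rgt0.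
  (* Here [lambda_max Q + eps] is [C0] times [lambda_min Q - eps], and the latter is smaller than
     [lambda_min (S w)]. *)
  rewrite -(ler_pM2l nV0) mulrCA; apply: (le_trans (ltW maxS)).
  rewrite /C0 mulrAC ler_pdivlMr//; apply: ler_wpM2l (ltW minS); apply: ltW.
  exact: lt_trans (lt_le_trans minS0 min_max) maxS.
apply/seteqP; split => w /= [].
  move=> G1; have := lambda_min_gram_gt0 D_gt0 G1 => G0.
  by rewrite /condition_number ler_pdivrMr.
move=> G0 Gle; split; last by rewrite /condition_number ler_pdivrMr.
exact: lambda_min_gt0_unitmx (gram_hermitian _) G0.
Qed.
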